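(* Let $k=0$ and let $a$ be a strongly regular scale factor (extended evenly to negative arguments). Then the metric coefficients of the extended Fermi metric \[ ds^2=g_{\tau\tau}d\tau^2+dx^2+dy^2+dz^2+\lambda_0\big[(y^2+z^2)dx^2+(x^2+z^2)dy^2+(x^2+y^2)dz^2-2xy\,dx\,dy-2xz\,dx\,dz-2yz\,dy\,dz\big], \] with $g_{\tau\tau}=g_{\tau\tau}(\tau,\rho)$, $\lambda_0=\lambda_0(\tau,\rho)$, $\rho=\sqrt{x^2+y^2+z^2}$, are continuous on $D_{\mathrm{Fermi}}$, and the metric coefficients $g_{\tau\tau}$, $g_{\rho\rho}=1$, $g_{\theta\theta}$, $g_{\phi\phi}$ of the polar form $ds^2=g_{\tau\tau}d\tau^2+d\rho^2+g_{\theta\theta}d\theta^2+g_{\phi\phi}d\phi^2$ are continuous on $D_{\mathrm{polar}}$.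
   Context: A function $a:[0,\infty)\to[0,\infty)$ is a regular scale factor if: (a) $a(0)=0$; (b) $a$ is increasing and continuous on $[0,\infty)$, twice continuously differentiable on $(0,\infty)$, with an inverse function on $[0,\infty)$; (c) $\frac{a(t)\ddot a(t)}{\dot a(t)^2}\le1$ for all $t>0$ (presupposing $\dot a(t)\ne0$). It is strongly regular if also $\frac{a\ddot a}{\dot a^2}\ge-K$ on $(0,\infty)$ for a constant $K\ge1$. Extend $a$ by $a(-t)=a(t)$. For $0<s<\tau$, $\chi_s(\tau)=\int_s^\tau\frac{1}{a(t)}\frac{a(\tau)}{\sqrt{a^2(\tau)-a^2(t)}}dt$. For $\tau>0$, $\rho_{\mathcal M_\tau}=\int_0^\tau\frac{a(t)}{\sqrt{a^2(\tau)-a^2(t)}}dt$; for $0\le\rho<2\rho_{\mathcal M_\tau}$, $t_0(\tau,\rho)$ is the unique $t_0\in(-\tau,\tau]$ with $\rho=\int_{t_0}^\tau\frac{a(t)}{\sqrt{a^2(\tau)-a^2(t)}}dt$. Define $f(\tau,t_0)=\int_{t_0}^{\tau}\frac{\ddot a(t)}{\dot a(t)^2}\left(\frac{\sqrt{a^2(\tau)-a^2(t_0)}}{\sqrt{a^2(\tau)-a^2(t)}}-1\right)dt$ for $0\le t_0\le\tau$, $f(\tau,t_0)=2f(\tau,0)-f(\tau,-t_0)$ for $-\tau<t_0<0$, and $g_{\tau\tau}(\tau,\rho)=-[1-\dot a(\tau)f(\tau,t_0(\tau,\rho))]^2$. Let $\rho_{\max}(\tau)=\inf\{\rho\in(0,2\rho_{\mathcal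 M_\tau}):g_{\tau\tau}(\tau,\rho)=0\}$ if nonempty, else $2\rho_{\mathcal M_\tau}$. $D_{\mathrm{Fermi}}=\{(\tau,x,y,z):\tau>0,\ \sqrt{x^2+y^2+z^2}<\rho_{\max}(\tau)\}$ and $D_{\mathrm{polar}}=\{(\tau,\rho,\theta,\phi):\tau>0,\ 0<\rho<\rho_{\max}(\tau),\ \theta\in I_\pi,\ \phi\in I_{2\pi}\}$ with $I_\pi,I_{2\pi}$ open intervals of lengths $\pi,2\pi$. For $\rho>0$ with $t_0=t_0(\tau,\rho)\ne0$: $g_{\theta\theta}(\tau,\rho)=a^2(t_0)\chi_{|t_0|}(\tau)^2$, with value at $\rho=\rho_{\mathcal M_\tau}$ given by the limit as $t_0\to0$; $g_{\phi\phi}(\tau,\rho,\theta)=g_{\theta\theta}(\tau,\rho)\sin^2\theta$; $\lambda_0(\tau,\rho)=\frac{g_{\theta\theta}(\tau,\rho)-\rho^2}{\rho^4}$ for $\rho>0$ and $\lambda_0(\tau,0)=0$. *)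

(* Defs.v *)
From Stdlib Require Import Reals ClassicalEpsilon.
From Coquelicot Require Import Coquelicot.
Open Scope R_scope.

Definition aext (a : R -> R) (t : R) : R := a (Rabs t).
Definition ad (a : R -> R) : R -> R := Derive a.
Definition add (a : R -> R) : R -> R := Derive (Derive a).

(* Regular scale factor (Def. in context), a given as a function R -> R, only
   its values on [0,oo) matter. *)
Definition regular_scale_factor (a : R -> R) : Prop :=
  a 0 = 0 /\
  (* increasing (strictly, since it has an inverse) on [0,oo) *)
  (forall s t, 0 <= s -> s < t -> a s < a t) /\
  (* a : [0,oo) -> [0,oo) has an inverse function defined on [0,oo) *)
  (forall y, 0 <= y -> exists t, 0 <= t /\ a t = y) /\
  continuous_on (fun t => 0 <= t) a /\
  (forall t, 0 < t ->
     ex_derive a t /\ ex_derive (Derive a) t /\ continuous (Derive (Derive a)) t) /\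
  (forall t, 0 < t -> ad a t <> 0 /\ a t * add a t / (ad a t) ^ 2 <= 1).

Definition strongly_regular_scale_factor (a : R -> R) : Prop :=
  regular_scale_factor a /\
  exists K : R, 1 <= K /\ forall t, 0 < t -> - K <= a t * add a t / (ad a t) ^ 2.

Definition Iimp (f : R -> R) (lo hi : R) : R :=
  if Rle_dec hi lo then 0 else RInt_gen f (at_right lo) (at_left hi).

Definition chi (a : R -> R) (s tau : R) : R :=
  Iimp (fun t => / a t * (a tau / sqrt (a tau ^ 2 - a t ^ 2))) s tau.

Definition rhoM (a : R -> R) (tau : R) : R :=
  Iimp (fun t => a t / sqrt (a tau ^ 2 - a t ^ 2)) 0 tau.

Definition rho_of (a : R -> R) (tau t0 : R) : R :=
  Iimp (fun t => aext a t / sqrt (a tau ^ 2 - aext a t ^ 2)) t0 tau.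

Definition t0fun (a : R -> R) (tau rho : R) : R :=
  iota (fun t0 : R => - tau < t0 <= tau /\ rho = rho_of a tau t0).

Definition fpos (a : R -> R) (tau t0 : R) : R :=
  Iimp (fun t => add a t / (ad a t) ^ 2 *
                 (sqrt (a tau ^ 2 - a t0 ^ 2) / sqrt (a tau ^ 2 - a t ^ 2) - 1)) t0 tau.

Definition ffun (a : R -> R) (tau t0 : R) : R :=
  if Rle_dec 0 t0 then fpos a tau t0 else 2 * fpos a tau 0 - fpos a tau (- t0).

Definition g_tautau (a : R -> R) (tau rho : R) : R :=
  - (1 - ad a tau * ffun a tau (t0fun a tau rho)) ^ 2.

Definition rho_max (a : R -> R) (tau : R) : R :=
  let S := fun r => 0 < r < 2 * rhoM a tau /\ g_tautau a tau r = 0 in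
  if excluded_middle_informative (exists r, S r) then real (Glb_Rbar S)
  else 2 * rhoM a tau.

Definition g_thth (a : R -> R) (tau rho : R) : R :=
  let t0 := t0fun a tau rho in
  if Req_EM_T t0 0 then
    real (Lim (fun s => aext a s ^ 2 * chi a (Rabs s) tau ^ 2) 0)
  else aext a t0 ^ 2 * chi a (Rabs t0) tau ^ 2.

Definition g_phph (a : R -> R) (tau rho theta : R) : R :=
  g_thth a tau rho * sin theta ^ 2.

Definition lambda0 (a : R -> R) (tau rho : R) : R :=
  if Rlt_dec 0 rho then (g_thth a tau rho - rho ^ 2) / rho ^ 4 else 0.

Definition radius (x y z : R) : R := sqrt (x ^ 2 + y ^ 2 + z ^ 2).

Definition D_Fermi (a : R -> R) (p : R * R * R * R) : Prop :=
  let '(tau, x, y, z) := p in 0 < tau /\ radius x y z < rho_max a tau.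

Definition D_polar (a : R -> R) (c d : R) (p : R * R * R * R) : Prop :=
  let '(tau, rho, theta, phi) := p in
  0 < tau /\ 0 < rho < rho_max a tau /\ c < theta < c + PI /\ d < phi < d + 2 * PI.

Definition gF_tt (a : R -> R) (p : R * R * R * R) : R :=
  let '(tau, x, y, z) := p in g_tautau a tau (radius x y z).
Definition gF_xx (a : R -> R) (p : R * R * R * R) : R :=
  let '(tau, x, y, z) := p in 1 + lambda0 a tau (radius x y z) * (y ^ 2 + z ^ 2).
Definition gF_yy (a : R -> R) (p : R * R * R * R) : R :=
  let '(tau, x, y, z) := p in 1 + lambda0 a tau (radius x y z) * (x ^ 2 + z ^ 2).
Definition gF_zz (a : R -> R) (p : R * R * R * R) : R :=
  let '(tau, x, y, z) := p in 1 + lambda0 a tau (radius x y z) * (x ^ 2 + y ^ 2).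
Definition gF_xy (a : R -> R) (p : R * R * R * R) : R :=
  let '(tau, x, y, z) := p in - (lambda0 a tau (radius x y z) * x * y).
Definition gF_xz (a : R -> R) (p : R * R * R * R) : R :=
  let '(tau, x, y, z) := p in - (lambda0 a tau (radius x y z) * x * z).
Definition gF_yz (a : R -> R) (p : R * R * R * R) : R :=
  let '(tau, x, y, z) := p in - (lambda0 a tau (radius x y z) * y * z).

Definition gP_tt (a : R -> R) (p : R * R * R * R) : R :=
  let '(tau, rho, theta, phi) := p in g_tautau a tau rho.
Definition gP_rr (a : R -> R) (p : R * R * R * R) : R := 1.
Definition gP_thth (a : R -> R) (p : R * R * R * R) : R :=
  let '(tau, rho, theta, phi) := p in g_thth a tau rho.
Definition gP_phph (a : R -> R) (p : R * R * R * R) : R :=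
  let '(tau, rho, theta, phi) := p in g_phph a tau rho theta.

(* Main.v *)
(* Substituting [t = tau - (tau - s) u^2], [0 <= u <= 1], and writing
   [a(tau)^2 - a(t)^2 = (tau - t) Q(tau, t)] with [Q] continuous and positive (also
   on the diagonal), every improper integral becomes, up to a factor
   [sqrt (tau - s)], a proper integral whose integrand is jointly continuous in
   [(tau, s, u)].  Only [t = 0] needs care.  For [f], the two terms of the
   integrand combine into [(a'' / a'^2)(t) (a(t)^2 - a(s)^2)], which strong
   regularity bounds by [K a(t)].  For [a(s) chi_s], the integrand carries
   [a(s) / a(t) <= 1], whose discontinuity at [(0, 0)] disappears after slowing
   down the parametrization at [t = s].  The length [rho] is strictly decreasing
   in [t0], so [t0] is jointly continuous in [(tau, rho)].  Near [rho = 0] both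
   [g_thth] and [rho^2] are [tau - t0] times functions with the same positive
   limit, so [lambda0 rho^2] tends to [0], which controls all the coefficients
   multiplied by [lambda0]. *)

Require Import Defs.
From Stdlib Require Import Reals Lra ClassicalEpsilon.
From Coquelicot Require Import Coquelicot.
Open Scope R_scope.

(** * Calculus of limits along an arbitrary filter *)

Section Limits.
Context {T : Type} {F : (T -> Prop) -> Prop} {FF : Filter F}.
Implicit Types f g : T -> R.

Lemma lim_comp (h : R -> R) f l :
  continuous h l -> filterlim f F (locally l) ->
  filterlim (fun x => h (f x)) F (locally (h l)).
Proof. intros Hh Hf. exact (filterlim_comp _ _ _ _ _ _ _ _ Hf Hh). Qed.

(** The source filter is arbitrary, so the same rule serves for full neighbourhoods and for
    neighbourhoods within a domain. *)
Lemma lim_comp2 {X Y Z : UniformSpace} (h : X -> Y -> Z) (f : T -> X) (g : T -> Y) l m :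
  continuous (fun p : X * Y => h (fst p) (snd p)) (l, m) ->
  filterlim f F (locally l) -> filterlim g F (locally m) ->
  filterlim (fun x => h (f x) (g x)) F (locally (h l m)).
Proof.
intros Hh Hf Hg.
apply (filterlim_comp_2 f g h Hf Hg).
intros P HP. specialize (Hh P HP). destruct Hh as [e He].
exists (ball l e) (ball m e); [apply locally_ball | apply locally_ball |].
intros x y Hx Hy. apply (He (x, y)). now split.
Qed.

Lemma lim_plus f g l m :
  filterlim f F (locally l) -> filterlim g F (locally m) ->
  filterlim (fun x => f x + g x) F (locally (l + m)).
Proof.
intros Hf Hg. exact (filterlim_comp_2 _ _ _ Hf Hg (filterlim_plus (V := R_NormedModule) l m)).
Qed.

Lemma lim_mult f g l m :
  filterlim f F (locally l) -> filterlim g F (locally m) ->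
  filterlim (fun x => f x * g x) F (locally (l * m)).
Proof.
intros Hf Hg. exact (filterlim_comp_2 _ _ _ Hf Hg (filterlim_mult (K := R_AbsRing) l m)).
Qed.

Lemma lim_opp f l :
  filterlim f F (locally l) -> filterlim (fun x => - f x) F (locally (- l)).
Proof. intros Hf. exact (filterlim_comp _ _ _ _ _ _ _ _ Hf (filterlim_opp (V := R_NormedModule) l)). Qed.

Lemma lim_minus f g l m :
  filterlim f F (locally l) -> filterlim g F (locally m) ->
  filterlim (fun x => f x - g x) F (locally (l - m)).
Proof. intros Hf Hg. apply lim_plus; [|apply lim_opp]; assumption. Qed.

Lemma lim_inv f l :
  l <> 0 -> filterlim f F (locally l) -> filterlim (fun x => / f x) F (locally (/ l)).
Proof. intros Hl Hf. exact (lim_comp Rinv f l (continuous_Rinv l Hl) Hf). Qed.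

Lemma lim_div f g l m :
  m <> 0 -> filterlim f F (locally l) -> filterlim g F (locally m) ->
  filterlim (fun x => f x / g x) F (locally (l / m)).
Proof. intros Hm Hf Hg. apply lim_mult; [|apply lim_inv]; assumption. Qed.

Lemma lim_sqrt f l :
  filterlim f F (locally l) -> filterlim (fun x => sqrt (f x)) F (locally (sqrt l)).
Proof. intros Hf. exact (lim_comp sqrt f l (continuous_sqrt l) Hf). Qed.

Lemma lim_abs f l :
  filterlim f F (locally l) -> filterlim (fun x => Rabs (f x)) F (locally (Rabs l)).
Proof. intros Hf. exact (lim_comp Rabs f l (continuous_Rabs l) Hf). Qed.

Lemma lim_pow f l n :
  filterlim f F (locally l) -> filterlim (fun x => f x ^ n) F (locally (l ^ n)).
Proof.
intros Hf. induction n as [|n IH]; simpl; [apply filterlim_const|].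
now apply lim_mult.
Qed.

Lemma lim_max f g l m :
  filterlim f F (locally l) -> filterlim g F (locally m) ->
  filterlim (fun x => Rmax (f x) (g x)) F (locally (Rmax l m)).
Proof.
assert (E : forall x y, (x + y + Rabs (x - y)) / 2 = Rmax x y).
{ intros x y. unfold Rmax, Rabs. destruct (Rle_dec x y), (Rcase_abs (x - y)); lra. }
intros Hf Hg. rewrite <- E.
apply (filterlim_ext (fun x => (f x + g x + Rabs (f x - g x)) / 2)).
- intros x. apply E.
- apply lim_div; [lra | | apply filterlim_const].
  apply lim_plus; [apply lim_plus; assumption |].
  apply lim_abs. now apply lim_minus.
Qed.

Lemma lim_min f g l m :
  filterlim f F (locally l) -> filterlim g F (locally m) ->
  filterlim (fun x => Rmin (f x) (g x)) F (locally (Rmin l m)).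
Proof.
assert (E : forall x y, - Rmax (- x) (- y) = Rmin x y).
{ intros x y. rewrite <- Ropp_Rmin. ring. }
intros Hf Hg. rewrite <- E.
apply (filterlim_ext (fun x => - Rmax (- f x) (- g x))).
- intros x. apply E.
- apply lim_opp, lim_max; now apply lim_opp.
Qed.

Lemma lim_bound0 f g :
  F (fun x => Rabs (f x) <= g x) -> filterlim g F (locally 0) ->
  filterlim f F (locally 0).
Proof.
intros Hfg Hg. apply filterlim_locally. intros eps.
assert (Hg' := proj1 (filterlim_locally g 0) Hg eps).
generalize (filter_and _ _ Hfg Hg'). apply filter_imp.
intros x [H1 H2].
unfold ball in *; simpl in *. unfold AbsRing_ball, abs, minus, plus, opp in *; simpl in *.
assert (H3 := Rle_abs (g x + - 0)). replace (f x + - 0) with (f x) by ring. lra.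
Qed.

End Limits.

Lemma lim_fst {X Y : UniformSpace} (z : X * Y) : filterlim fst (locally z) (locally (fst z)).
Proof. destruct z. exact (continuous_fst _ _). Qed.

Lemma lim_snd {X Y : UniformSpace} (z : X * Y) : filterlim snd (locally z) (locally (snd z)).
Proof. destruct z. exact (continuous_snd _ _). Qed.

Lemma continuous_lim {X Y : UniformSpace} (h : X -> Y) x :
  filterlim h (locally x) (locally (h x)) -> continuous h x.
Proof. intros H; exact H. Qed.

(** * Integrals depending on a parameter *)

(** Compactness of [[0, 1]] turns joint continuity at each [(p, u)] into one radius around [p] on
    which [N q] is uniformly close to [N p]. Continuity is assumed for all parameters near [p] so
    that every [N q] involved is integrable. *)
Lemma RInt_param_continuous {U : UniformSpace} (N : U -> R -> R) (p : U) :
  locally p (fun q => forall u, 0 <= u <= 1 ->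
    continuous (fun z : U * R => N (fst z) (snd z)) (q, u)) ->
  continuous (fun q => RInt (N q) 0 1) p.
Proof.
intros Hloc.
assert (Hex : forall q, (forall u, 0 <= u <= 1 ->
    continuous (fun z : U * R => N (fst z) (snd z)) (q, u)) -> ex_RInt (N q) 0 1).
{ intros q Hq. apply (ex_RInt_continuous (V := R_CompleteNormedModule)).
  intros u Hu. rewrite Rmin_left, Rmax_right in Hu by lra.
  apply continuous_lim.
  apply (lim_comp2 N (fun _ => q) (fun v => v) q u (Hq u Hu)).
  apply filterlim_const. apply filterlim_id. }
assert (Hp := locally_singleton _ _ Hloc).
apply filterlim_locally. intros eps.
assert (He4 : 0 < eps / 4) by (generalize (cond_pos eps); lra).
assert (Hd : forall u, exists d : posreal, 0 <= u <= 1 -> forall z : U * R, ball (p, u) d z ->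
   Rabs (N (fst z) (snd z) - N p u) < eps / 4).
{ intros u. destruct (excluded_middle_informative (0 <= u <= 1)) as [Hu | Hu].
  - assert (H := proj1 (filterlim_locally _ _) (Hp u Hu) (mkposreal _ He4)).
    destruct H as [d Hd]. exists d. intros _. exact Hd.
  - exists (mkposreal 1 Rlt_0_1). tauto. }
pose (delta u := proj1_sig (constructive_indefinite_description _ (Hd u))).
assert (Hdelta : forall u, 0 <= u <= 1 -> forall z : U * R, ball (p, u) (delta u) z ->
   Rabs (N (fst z) (snd z) - N p u) < eps / 4).
{ intros u. exact (proj2_sig (constructive_indefinite_description _ (Hd u))). }
destruct (compactness_value_1d 0 1 delta) as [d Hcd].
generalize (filter_and _ _ Hloc (locally_ball p d)). apply filter_imp.
intros q [Hq Hball].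
assert (Hclose : forall u, 0 <= u <= 1 -> Rabs (N q u - N p u) <= eps / 2).
(* The covering property holds only under a double negation, hence the argument by contradiction.
   Both [N q u] and [N p u] are compared with [N p t], where [t] is the centre of a covering
   interval. *)
{ intros u Hu. apply Rnot_lt_le. intros Hlt. apply (Hcd u Hu).
  intros [t (Ht & Hut & Hdt)].
  assert (Hu1 : ball t (delta t) u) by exact Hut.
  assert (H1 := Hdelta t Ht (q, u) (conj (ball_le _ _ _ Hdt _ Hball) Hu1)).
  assert (H2 := Hdelta t Ht (p, u) (conj (ball_center _ _) Hu1)).
  simpl in H1, H2. revert Hlt H1 H2.
  unfold Rabs. repeat destruct Rcase_abs; lra. }
change (Rabs (RInt (N q) 0 1 - RInt (N p) 0 1) < eps).
assert (E : RInt (N q) 0 1 - RInt (N p) 0 1 = RInt (fun u => N q u - N p u) 0 1).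
{ symmetry. apply is_RInt_unique.
  apply (is_RInt_minus (V := R_NormedModule)); apply (RInt_correct (V := R_CompleteNormedModule)); now apply Hex. }
rewrite E.
apply Rle_lt_trans with ((1 - 0) * (eps / 2)).
- apply abs_RInt_le_const; [lra | | exact Hclose].
  apply (ex_RInt_minus (V := R_NormedModule)); now apply Hex.
- generalize (cond_pos eps); lra.
Qed.

Lemma RInt_ext_01 (f g : R -> R) : (forall u, 0 < u < 1 -> f u = g u) -> RInt f 0 1 = RInt g 0 1.
Proof.
intros H. apply RInt_ext. intros u Hu. rewrite Rmin_left, Rmax_right in Hu by lra. now apply H.
Qed.

Lemma RInt_const_01 (c : R) : RInt (fun _ => c) 0 1 = c.
Proof.
rewrite (RInt_const (V := R_CompleteNormedModule)).
change ((1 - 0) * c = c). ring.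
Qed.

Lemma ex_RInt_01 (N : R -> R) : (forall u, 0 <= u <= 1 -> continuous N u) -> ex_RInt N 0 1.
Proof.
intros HN. apply (ex_RInt_continuous (V := R_CompleteNormedModule)).
intros u Hu. rewrite Rmin_left, Rmax_right in Hu by lra. now apply HN.
Qed.

Lemma RInt_mult_l (N : R -> R) c : (forall u, 0 <= u <= 1 -> continuous N u) ->
  RInt (fun u => c * N u) 0 1 = c * RInt N 0 1.
Proof. intros HN. apply (RInt_scal (V := R_CompleteNormedModule)). now apply ex_RInt_01. Qed.

(** The change of variable [u = v (2 - v)] maps [[0, 1]] increasingly onto itself, with a derivative
    that vanishes at [v = 1]. *)
Lemma RInt_double_speed (N : R -> R) : (forall u, 0 <= u <= 1 -> continuous N u) ->
  RInt (fun v => 2 * (1 - v) * N (v * (2 - v))) 0 1 = RInt N 0 1.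
Proof.
intros HN.
replace (RInt N 0 1) with (RInt N (0 * (2 - 0)) (1 * (2 - 1))) by (f_equal; ring).
apply (RInt_comp (V := R_CompleteNormedModule) N (fun v => v * (2 - v)) (fun v => 2 * (1 - v))).
- intros v Hv. rewrite Rmin_left, Rmax_right in Hv by lra. apply HN. nra.
- intros v Hv. split; [auto_derive; [easy | ring] |].
  apply continuous_lim, lim_mult; [apply filterlim_const |].
  apply lim_minus; [apply filterlim_const | apply filterlim_id].
Qed.

(** * Improper integrals turned into proper ones by substitution *)

(** Composition with this retraction extends an integrand continuously from [[0, 1]] to the line, so
    that its integral is continuous in both endpoints without side conditions. *)
Definition clamp01 (u : R) : R := Rmax 0 (Rmin 1 u).

Lemma clamp01_in u : 0 <= clamp01 u <= 1.
Proof. unfold clamp01, Rmax, Rmin. repeat destruct Rle_dec; lra. Qed.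

Lemma clamp01_id u : 0 <= u <= 1 -> clamp01 u = u.
Proof. intros Hu. unfold clamp01, Rmax, Rmin. repeat destruct Rle_dec; lra. Qed.

(* The substitution [t = hi - (hi - lo) u^2] removes an inverse square root
   singularity of [f] at [hi]. *)
Lemma is_RInt_gen_subst (Fa : (R -> Prop) -> Prop) {FFa : Filter Fa} (f N : R -> R) (lo hi : R) :
  lo < hi -> filter_le Fa (locally lo) -> Fa (fun x => lo <= x < hi /\ continuous f x) ->
  (forall t, lo < t < hi -> continuous f t) ->
  (forall u, 0 <= u <= 1 -> continuous N u) ->
  (forall u, 0 < u < 1 -> N u = f (hi - (hi - lo) * u ^ 2) * (2 * (hi - lo) * u)) ->
  is_RInt_gen f Fa (at_left hi) (RInt N 0 1).
Proof.
intros Hlt HFa HFa' Hf HN HE.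
pose (Nc u := N (clamp01 u)).
assert (HNc : forall u, continuous Nc u).
{ intros u. apply continuous_lim. unfold Nc.
  apply (lim_comp N clamp01 (clamp01 u) (HN _ (clamp01_in u))).
  apply lim_max; [apply filterlim_const | apply lim_min; [apply filterlim_const | apply filterlim_id]]. }
assert (HexN : forall x y, ex_RInt Nc x y).
{ intros x y. apply (ex_RInt_continuous (V := R_CompleteNormedModule)). intros; apply HNc. }
(* Inverse of the substitution: [v] sends [lo] to [1] and [hi] to [0]. *)
pose (v x := sqrt ((hi - x) / (hi - lo))).
assert (Hv : forall x, lo <= x < hi -> 0 < v x <= 1 /\ hi - (hi - lo) * v x ^ 2 = x).
{ intros x Hx. unfold v.
  assert (0 < (hi - x) / (hi - lo)) by (apply Rdiv_lt_0_compat; lra).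
  assert ((hi - x) / (hi - lo) <= 1) by (apply Rle_div_l; lra).
  repeat split.
  - now apply sqrt_lt_R0.
  - rewrite <- sqrt_1. apply sqrt_le_1; lra.
  - rewrite pow2_sqrt by lra. field. lra. }
assert (Hvc : forall x, filterlim v (locally x) (locally (v x))).
{ intros x. unfold v. apply lim_sqrt, lim_div; [lra | | apply filterlim_const].
  apply lim_minus; [apply filterlim_const | apply filterlim_id]. }
assert (Hv1 : v lo = 1).
{ unfold v. replace ((hi - lo) / (hi - lo)) with 1 by (field; lra). apply sqrt_1. }
assert (Hv0 : v hi = 0).
{ unfold v. replace ((hi - hi) / (hi - lo)) with 0 by (field; lra). apply sqrt_0. }
rewrite (RInt_ext_01 N Nc) by (intros u Hu; unfold Nc; rewrite clamp01_id; [easy | lra]).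
intros P HP.
assert (Hlim : filterlim (fun xy : R * R => RInt Nc (v (snd xy)) (v (fst xy)))
   (filter_prod Fa (at_left hi)) (locally (RInt Nc 0 1))).
{ apply (lim_comp2 (fun x y => RInt Nc x y)).
  - apply (continuous_RInt Nc 0 1 (fun x y => RInt Nc x y)).
    apply filter_forall. intros z. apply (RInt_correct (V := R_CompleteNormedModule)), HexN.
  - rewrite <- Hv0. eapply filterlim_comp; [apply filterlim_snd |].
    eapply filterlim_filter_le_1; [| apply Hvc]. apply filter_le_within.
  - rewrite <- Hv1. eapply filterlim_comp; [apply filterlim_fst |].
    eapply filterlim_filter_le_1; [exact HFa | apply Hvc]. }
assert (Hin : filter_prod Fa (at_left hi)
   (fun xy => (lo <= fst xy < hi /\ continuous f (fst xy)) /\ lo < snd xy < hi)).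
{ assert (Hpos : 0 < hi - lo) by lra.
  exists (fun x => lo <= x < hi /\ continuous f x) (fun y => lo < y < hi).
  - exact HFa'.
  - exists (mkposreal _ Hpos). intros x Hx Hx'. apply Rabs_lt_between' in Hx. simpl in Hx. lra.
  - simpl. tauto. }
assert (HlimP := Hlim P HP). unfold filtermap in HlimP. unfold filtermapi.
generalize (filter_and _ _ Hin HlimP). apply filter_imp.
intros [x y] [[[Hx Hfx] Hy] HPxy]. cbn [fst snd] in *.
(* The substitution reverses orientation, so the integral from [x] to [y] becomes one from [v y] to
   [v x]. *)
exists (RInt Nc (v y) (v x)). split; [| exact HPxy].
destruct (Hv x Hx) as [Hvx Ex]. destruct (Hv y ltac:(lra)) as [Hvy Ey].
assert (Hfc : forall t, Rmin x y <= t <= Rmax x y -> continuous f t).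
(* The lower endpoint [x] may equal [lo], where continuity of [f] is only known through the filter
   [Fa]. *)
{ intros t Ht. destruct (Req_dec t x) as [-> | Hne]; [exact Hfx |].
  apply Hf. revert Ht. unfold Rmin, Rmax. destruct (Rle_dec x y); lra. }
replace (RInt Nc (v y) (v x)) with (RInt f x y);
  [now apply (RInt_correct (V := R_CompleteNormedModule)),
     (ex_RInt_continuous (V := R_CompleteNormedModule)) |].
transitivity (RInt f (hi - (hi - lo) * v x ^ 2) (hi - (hi - lo) * v y ^ 2)); [now rewrite Ex, Ey |].
rewrite <- (RInt_comp (V := R_CompleteNormedModule) f (fun u => hi - (hi - lo) * u ^ 2) (fun u => - (2 * (hi - lo) * u))).
- assert (Hsw := opp_RInt_swap (V := R_CompleteNormedModule) Nc (v x) (v y) (HexN _ _)).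
  rewrite <- Hsw. rewrite <- (RInt_opp (V := R_CompleteNormedModule)) by apply HexN.
  apply RInt_ext. intros u Hu.
  assert (Hu01 : 0 < u < 1).
  { revert Hu. unfold Rmin, Rmax. destruct (Rle_dec (v x) (v y)); lra. }
  unfold Nc. rewrite clamp01_id by lra. rewrite HE by easy.
  unfold scal, opp; simpl. unfold mult; simpl. ring.
- intros u Hu. apply Hfc.
  assert (Hu' : Rmin (v x ^ 2) (v y ^ 2) <= u ^ 2 <= Rmax (v x ^ 2) (v y ^ 2)).
  { revert Hu. unfold Rmin, Rmax.
    destruct (Rle_dec (v x) (v y)), (Rle_dec (v x ^ 2) (v y ^ 2)); nra. }
  revert Hu' Ex Ey.
  set (p := v x ^ 2). set (q := v y ^ 2). set (w := u ^ 2).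
  intros Hw Ex Ey. revert Hw.
  unfold Rmin, Rmax.
  destruct (Rle_dec p q), (Rle_dec x y); nra.
- intros u Hu. split.
  + auto_derive; [easy | ring].
  + apply continuous_lim. apply lim_opp, lim_mult; [apply filterlim_const | apply filterlim_id].
Qed.

Lemma Iimp_subst (f N : R -> R) (lo hi : R) :
  lo < hi ->
  (forall t, lo < t < hi -> continuous f t) ->
  (forall u, 0 <= u <= 1 -> continuous N u) ->
  (forall u, 0 < u < 1 -> N u = f (hi - (hi - lo) * u ^ 2) * (2 * (hi - lo) * u)) ->
  Iimp f lo hi = RInt N 0 1.
Proof.
intros Hlt Hf HN HE. unfold Iimp. destruct (Rle_dec hi lo) as [H|_]; [lra|].
apply is_RInt_gen_unique, (is_RInt_gen_subst _ f N lo hi); try easy.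
- apply filter_le_within.
- assert (Hpos : 0 < hi - lo) by lra.
  exists (mkposreal _ Hpos). intros x Hx Hx'. apply Rabs_lt_between' in Hx. simpl in Hx.
  split; [| apply Hf]; lra.
Qed.

(** * The quadratic parametrization and the coordinate projections *)

Definition sub (tau s u : R) : R := tau - (tau - s) * u ^ 2.

Lemma lim_sub {T} {F : (T -> Prop) -> Prop} {FF : Filter F} (f g h : T -> R) tau s u :
  filterlim f F (locally tau) -> filterlim g F (locally s) -> filterlim h F (locally u) ->
  filterlim (fun x => sub (f x) (g x) (h x)) F (locally (sub tau s u)).
Proof.
intros Hf Hg Hh. unfold sub.
apply lim_minus; [easy | apply lim_mult; [now apply lim_minus | now apply lim_pow]].
Qed.

(** The point [sub tau s u] is the convex combination of [tau] and [s] with weight [u^2] on [s]. No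
    order between [s] and [tau] is imposed, since neighbourhoods of the diagonal contain points with
    [s > tau]. *)
Lemma sub_gt tau s u b : b < tau -> b < s -> 0 <= u <= 1 -> b < sub tau s u.
Proof.
intros Ht Hs Hu. unfold sub.
assert (H : 0 <= u ^ 2 <= 1) by (split; nra).
set (w := u ^ 2) in *. destruct (Rle_lt_dec w (1 / 2)); nra.
Qed.

Lemma sub_between tau s u : s <= tau -> 0 <= u <= 1 -> s <= sub tau s u <= tau.
Proof.
intros Hs Hu. unfold sub.
assert (H : 0 <= u ^ 2 <= 1) by (split; nra).
set (w := u ^ 2) in *. nra.
Qed.

Lemma sub_between_strict tau s u : s < tau -> 0 < u < 1 -> s < sub tau s u < tau.
Proof.
intros Hs Hu. unfold sub.
assert (H : 0 < u ^ 2 < 1) by (split; nra).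
set (w := u ^ 2) in *. nra.
Qed.

Lemma lim_pair1 (x y : R) : filterlim fst (locally (x, y)) (locally x).
Proof. exact (continuous_fst x y). Qed.

Lemma lim_pair2 (x y : R) : filterlim snd (locally (x, y)) (locally y).
Proof. exact (continuous_snd x y). Qed.

Lemma lim_triple1 (x y z : R) :
  filterlim (fun p : R * R * R => fst (fst p)) (locally (x, y, z)) (locally x).
Proof. exact (filterlim_comp _ _ _ _ _ _ _ _ (continuous_fst (x, y) z) (continuous_fst x y)). Qed.

Lemma lim_triple2 (x y z : R) :
  filterlim (fun p : R * R * R => snd (fst p)) (locally (x, y, z)) (locally y).
Proof. exact (filterlim_comp _ _ _ _ _ _ _ _ (continuous_fst (x, y) z) (continuous_snd x y)). Qed.

Lemma lim_triple3 (x y z : R) :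
  filterlim (fun p : R * R * R => snd p) (locally (x, y, z)) (locally z).
Proof. exact (continuous_snd (x, y) z). Qed.

Lemma continuous_slice (N : R * R -> R -> R) p u :
  continuous (fun z : R * R * R => N (fst z) (snd z)) (p, u) -> continuous (N p) u.
Proof.
intros H. apply continuous_lim.
apply (lim_comp2 N (fun _ => p) (fun v => v) p u H).
apply filterlim_const. apply filterlim_id.
Qed.

Lemma lim_gt {T} {F : (T -> Prop) -> Prop} {FF : Filter F} (f : T -> R) l c :
  filterlim f F (locally l) -> c < l -> F (fun x => c < f x).
Proof. intros Hf Hc. exact (Hf _ (open_gt c l Hc)). Qed.

Lemma lim_lt {T} {F : (T -> Prop) -> Prop} {FF : Filter F} (f : T -> R) l c :
  filterlim f F (locally l) -> l < c -> F (fun x => f x < c).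
Proof. intros Hf Hc. exact (Hf _ (open_lt c l Hc)). Qed.

Lemma lim_pair {T} {F : (T -> Prop) -> Prop} {FF : Filter F} {X Y : UniformSpace} (f : T -> X) (g : T -> Y) l m :
  filterlim f F (locally l) -> filterlim g F (locally m) ->
  filterlim (fun x => (f x, g x)) F (locally (l, m)).
Proof.
intros Hf Hg. apply (lim_comp2 (fun x y => (x, y))); [| easy | easy].
apply (continuous_ext (fun p => p)); [now intros [? ?] | apply continuous_id].
Qed.

(** Used to pull continuity of functions of [(tau, rho)] back to the Cartesian and polar charts. *)
Lemma lim_within_map {X Y Z : UniformSpace} (D : X -> Prop) (E : Y -> Prop) (h : X -> Y) (f : Y -> Z) x l :
  (forall x, D x -> E (h x)) -> continuous h x ->
  filterlim f (within E (locally (h x))) (locally l) ->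
  filterlim (fun x => f (h x)) (within D (locally x)) (locally l).
Proof.
intros HDE Hh Hf.
apply (filterlim_comp _ _ _ h f _ (within E (locally (h x)))); [| exact Hf].
intros P HP. unfold filtermap, within in *.
apply (filter_imp (fun y => E (h y) -> P (h y))); [| exact (Hh _ HP)]. intros y Hy HD. apply Hy. now apply HDE.
Qed.

Lemma Iimp_degenerate f t : Iimp f t t = 0.
Proof. unfold Iimp. destruct (Rle_dec t t) as [_ | []]; lra. Qed.

(** Passes between coefficients defined by matching on a tuple and the same functions written with
    projections. *)
Lemma continuous_on_eq {X Y : UniformSpace} (D : X -> Prop) (f g : X -> Y) :
  (forall x, f x = g x) -> continuous_on D f -> continuous_on D g.
Proof.
intros E Hf x Hx. rewrite <- E. apply (filterlim_ext f); [exact E | now apply Hf].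
Qed.

(** * Coordinates of the four-dimensional charts and the radius *)

Definition tau4 (p : R * R * R * R) : R := fst (fst (fst p)).
Definition x4 (p : R * R * R * R) : R := snd (fst (fst p)).
Definition y4 (p : R * R * R * R) : R := snd (fst p).
Definition z4 (p : R * R * R * R) : R := snd p.

Lemma lim_tau4 p : filterlim tau4 (locally p) (locally (tau4 p)).
Proof. exact (filterlim_comp _ _ _ _ _ _ _ _ (lim_fst p) (filterlim_comp _ _ _ _ _ _ _ _ (lim_fst (fst p)) (lim_fst (fst (fst p))))). Qed.

Lemma lim_x4 p : filterlim x4 (locally p) (locally (x4 p)).
Proof. exact (filterlim_comp _ _ _ _ _ _ _ _ (lim_fst p) (filterlim_comp _ _ _ _ _ _ _ _ (lim_fst (fst p)) (lim_snd (fst (fst p))))). Qed.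

Lemma lim_y4 p : filterlim y4 (locally p) (locally (y4 p)).
Proof. exact (filterlim_comp _ _ _ _ _ _ _ _ (lim_fst p) (lim_snd (fst p))). Qed.

Lemma lim_z4 p : filterlim z4 (locally p) (locally (z4 p)).
Proof. exact (lim_snd p). Qed.

Definition tau_radius (p : R * R * R * R) : R * R :=
  let '(tau, x, y, z) := p in (tau, radius x y z).

Lemma tau_radius_continuous p : continuous tau_radius p.
Proof.
apply (continuous_ext (fun p => (tau4 p, sqrt (x4 p ^ 2 + y4 p ^ 2 + z4 p ^ 2)))).
- now intros [[[? ?] ?] ?].
- apply continuous_lim. apply lim_pair; [apply lim_tau4 |].
  apply lim_sqrt. repeat apply lim_plus; apply lim_pow; [apply lim_x4 | apply lim_y4 | apply lim_z4].
Qed.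

(** * The scale factor and the slope of its square *)

Section ScaleFactor.
Context (a : R -> R) (Ha : regular_scale_factor a).

Lemma scale_0 : a 0 = 0.
Proof. exact (proj1 Ha). Qed.

Lemma scale_incr s t : 0 <= s -> s < t -> a s < a t.
Proof. apply (proj1 (proj2 Ha)). Qed.

Lemma aext_pos_eq t : 0 <= t -> aext a t = a t.
Proof. intros Ht. unfold aext. now rewrite Rabs_pos_eq. Qed.

Lemma aext_incr s t : Rabs s < Rabs t -> aext a s < aext a t.
Proof. intros H. apply scale_incr; [apply Rabs_pos | exact H]. Qed.

Lemma aext_pos t : t <> 0 -> 0 < aext a t.
Proof.
intros Ht. rewrite <- scale_0. apply scale_incr; [lra | now apply Rabs_pos_lt].
Qed.

Lemma aext_0 : aext a 0 = 0.
Proof. rewrite aext_pos_eq by lra. apply scale_0. Qed.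

Lemma aext_nonneg t : 0 <= aext a t.
Proof.
destruct (Req_dec t 0) as [-> | Ht]; [rewrite aext_0; lra | generalize (aext_pos t Ht); lra].
Qed.

Lemma aext_continuous t : continuous (aext a) t.
Proof.
destruct Ha as (_ & _ & _ & Hc & _).
intros P HP.
destruct (Hc (Rabs t) (Rabs_pos t) P HP) as [e He].
assert (H := continuous_Rabs t _ (locally_ball (Rabs t) e)).
unfold filtermap in *. revert H. apply filter_imp. intros x Hx. apply He; [exact Hx | apply Rabs_pos].
Qed.

Lemma ad_continuous t : 0 < t -> continuous (ad a) t.
Proof.
intros Ht. destruct Ha as (_ & _ & _ & _ & Hd & _).
apply (ex_derive_continuous (V := R_NormedModule)). now apply Hd.
Qed.

Lemma scale_is_derive t : 0 < t -> is_derive a t (ad a t).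
Proof.
intros Ht. destruct Ha as (_ & _ & _ & _ & Hd & _). apply Derive_correct. now apply Hd.
Qed.

(** Regularity only gives [a' <> 0]. A negative derivative would stay negative near [t] by
    continuity, and the mean value theorem would then contradict the growth of [a]. *)
Lemma ad_pos t : 0 < t -> 0 < ad a t.
Proof.
intros Ht. apply Rnot_le_lt. intros Hle.
assert (Hlt : ad a t < 0).
{ destruct Ha as (_ & _ & _ & _ & _ & Hn). destruct (Hn t Ht) as [Hne _]. lra. }
assert (Hneg : 0 < - ad a t) by lra.
destruct (proj1 (filterlim_locally _ _) (ad_continuous t Ht) (mkposreal _ Hneg)) as [e He].
assert (He0 := cond_pos e).
destruct (MVT_gen a t (t + e / 2) (ad a)) as (c & Hc & E).
- intros x Hx. rewrite Rmin_left in Hx by lra. apply scale_is_derive. lra.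
- intros x Hx. rewrite Rmin_left in Hx by lra. apply continuity_pt_filterlim.
  apply (ex_derive_continuous (V := R_NormedModule)). exists (ad a x). apply scale_is_derive. lra.
- rewrite Rmin_left, Rmax_right in Hc by lra.
  assert (Hb : ball t e c).
  { change (Rabs (c - t) < e). rewrite Rabs_pos_eq; lra. }
  assert (H := He c Hb). change (Rabs (ad a c - ad a t) < - ad a t) in H.
  apply Rabs_def2 in H.
  assert (Hi := scale_incr t (t + e / 2) ltac:(lra) ltac:(lra)).
  assert (0 <= c - t) by lra. nra.
Qed.

Lemma aext_sqr_is_derive t : 0 < t -> is_derive (fun x => aext a x ^ 2) t (2 * a t * ad a t).
Proof.
intros Ht. apply (is_derive_ext_loc (fun x => a x ^ 2)).
- exists (mkposreal t Ht). intros x Hx. apply Rabs_lt_between' in Hx. simpl in Hx.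
  rewrite aext_pos_eq; [easy | lra].
- assert (H := scale_is_derive t Ht).
  auto_derive; [now exists (ad a t) |]. change (Derive (fun x => a x) t) with (ad a t). simpl. ring.
Qed.

(** The factor [Q] in [a(tau)^2 - a(t)^2 = (tau - t) Q(tau, t)]: a divided difference, completed on
    the diagonal by the derivative of [a^2]. *)
Definition slope (tau t : R) : R :=
  if Req_EM_T t tau then 2 * a tau * ad a tau
  else (aext a tau ^ 2 - aext a t ^ 2) / (tau - t).

Lemma slope_eq tau t : aext a tau ^ 2 - aext a t ^ 2 = (tau - t) * slope tau t.
Proof.
unfold slope. destruct (Req_EM_T t tau) as [-> | H]; [ring | field; lra].
Qed.

(** Off the diagonal, numerator and denominator have the same sign: for [t > - tau], the conditions
    [t < tau] and [|t| < tau] are equivalent. *)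
Lemma slope_pos tau t : 0 < tau -> - tau < t -> 0 < slope tau t.
Proof.
intros Htau Ht. unfold slope. destruct (Req_EM_T t tau) as [E | E].
- assert (H1 := ad_pos tau Htau). assert (H2 := aext_pos tau ltac:(lra)).
  rewrite aext_pos_eq in H2 by lra. nra.
- destruct (Rlt_or_le t tau) as [H | H].
  + assert (Hi : aext a t < aext a tau).
    { apply aext_incr. rewrite (Rabs_pos_eq tau) by lra. apply Rabs_def1; lra. }
    assert (Hn := aext_nonneg t). apply Rdiv_lt_0_compat; [nra | lra].
  + assert (Hi : aext a tau < aext a t).
    { apply aext_incr. rewrite !Rabs_pos_eq; lra. }
    assert (Hn := aext_nonneg tau).
    replace ((aext a tau ^ 2 - aext a t ^ 2) / (tau - t))
      with ((aext a t ^ 2 - aext a tau ^ 2) / (t - tau)) by (field; lra).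
    apply Rdiv_lt_0_compat; [nra | lra].
Qed.

(** Near the diagonal, the mean value theorem writes the slope as [2 a(z) a'(z)] with [z] close to
    [tau]. Elsewhere it is locally a quotient with nonzero denominator. *)
Lemma slope_continuous tau t : 0 < tau -> - tau < t ->
  continuous (fun p => slope (fst p) (snd p)) (tau, t).
Proof.
intros Htau Ht. apply continuous_lim; cbn [fst snd].
destruct (Req_dec t tau) as [E | E].
- subst t.
  assert (Hc : continuous (fun x => 2 * aext a x * ad a x) tau).
  { apply continuous_lim. apply lim_mult; [| now apply ad_continuous].
    apply lim_mult; [apply filterlim_const | apply aext_continuous]. }
  apply filterlim_locally. intros eps.
  destruct (proj1 (filterlim_locally _ _) Hc eps) as [e He].
  (* The cap by [tau] keeps [x], [y] and [z] positive, where [a] is differentiable. *)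
  pose (d := Rmin e tau).
  assert (Hd : 0 < d) by (apply Rmin_pos; [apply cond_pos | exact Htau]).
  assert (Hde : d <= e) by apply Rmin_l. assert (Hdt : d <= tau) by apply Rmin_r.
  exists (mkposreal d Hd). intros [x y] [Hx Hy]; cbn [fst snd] in *.
  apply Rabs_lt_between' in Hx, Hy. cbn [pos] in Hx, Hy.
  assert (Hz : exists z, tau - d < z < tau + d /\ slope x y = 2 * aext a z * ad a z).
  { unfold slope. destruct (Req_EM_T y x) as [-> | Hne].
    - exists x. split; [lra |]. now rewrite aext_pos_eq by lra.
    - destruct (MVT_gen (fun z => aext a z ^ 2) y x (fun z => 2 * a z * ad a z)) as (c & Hc' & Ec).
      + intros z [Hz _]. apply aext_sqr_is_derive.
        revert Hz. unfold Rmin. destruct (Rle_dec y x); lra.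
      + intros z _. apply continuity_pt_filterlim. exact (lim_pow _ _ 2 (aext_continuous z)).
      + exists c.
        assert (tau - d < c < tau + d).
        { revert Hc'. unfold Rmin, Rmax. destruct (Rle_dec y x); lra. }
        split; [easy |]. rewrite Ec, (aext_pos_eq c) by lra. field. lra. }
  destruct Hz as (z & Hz & ->).
  unfold slope. destruct (Req_EM_T tau tau) as [_ | []]; [| reflexivity].
  replace (a tau) with (aext a tau) by (apply aext_pos_eq; lra).
  apply He. apply Rabs_def1; unfold minus, plus, opp; simpl; lra.
- unfold slope at 2. destruct (Req_EM_T t tau) as [| _]; [easy |].
  apply (filterlim_ext_loc (fun p : R * R => (aext a (fst p) ^ 2 - aext a (snd p) ^ 2) / (fst p - snd p))).
  (* Within half the distance from [t] to [tau], the two coordinates cannot meet. *)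
  + assert (Hd : 0 < Rabs (t - tau) / 2) by (assert (H := Rabs_pos_lt (t - tau)); lra).
    exists (mkposreal _ Hd). intros [x y] [Hx Hy]; cbn [fst snd] in *.
    unfold slope. destruct (Req_EM_T y x) as [-> | _]; [exfalso | easy].
    change (Rabs (x - tau) < Rabs (t - tau) / 2) in Hx.
    change (Rabs (x - t) < Rabs (t - tau) / 2) in Hy.
    revert Hx Hy. unfold Rabs. repeat destruct Rcase_abs; lra.
  + apply lim_div; [lra | |].
    * apply lim_minus; apply lim_pow; apply (lim_comp (aext a)); try apply aext_continuous;
        [apply lim_pair1 | apply lim_pair2].
    * apply lim_minus; [apply lim_pair1 | apply lim_pair2].
Qed.

(** The Jacobian [2 (tau - s) u] cancels the singular factor [sqrt ((tau - s) u^2)] of the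
    denominator and leaves [sqrt (tau - s)]. *)
Lemma kernel_subst tau s u : 0 < tau -> - tau < s < tau -> 0 < u <= 1 ->
  2 * (tau - s) * u / sqrt (aext a tau ^ 2 - aext a (sub tau s u) ^ 2) =
  2 * sqrt (tau - s) / sqrt (slope tau (sub tau s u)).
Proof.
intros Htau Hs Hu.
assert (Hq := slope_pos tau (sub tau s u) Htau (sub_gt tau s u (- tau) ltac:(lra) ltac:(lra) ltac:(lra))).
rewrite slope_eq.
replace (tau - sub tau s u) with ((tau - s) * u ^ 2) by (unfold sub; ring).
rewrite !sqrt_mult by nra.
rewrite sqrt_pow2 by lra.
assert (H1 := sqrt_lt_R0 (tau - s) ltac:(lra)).
assert (H2 := sqrt_lt_R0 _ Hq).
assert (H3 := sqrt_sqrt (tau - s) ltac:(lra)).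
rewrite <- H3 at 1. field. lra.
Qed.

Lemma kernel_continuous tau t : 0 < tau -> - tau < t < tau ->
  continuous (fun t => / sqrt (aext a tau ^ 2 - aext a t ^ 2)) t.
Proof.
intros Htau Ht. apply continuous_lim.
apply lim_inv.
- apply Rgt_not_eq, sqrt_lt_R0. rewrite slope_eq.
  apply Rmult_lt_0_compat; [lra | apply slope_pos; lra].
- apply lim_sqrt, lim_minus; [apply filterlim_const | apply lim_pow, aext_continuous].
Qed.

Lemma lim_slope {T} {F : (T -> Prop) -> Prop} {FF : Filter F} (f g : T -> R) tau t :
  0 < tau -> - tau < t ->
  filterlim f F (locally tau) -> filterlim g F (locally t) ->
  filterlim (fun x => sqrt (slope (f x) (g x))) F (locally (sqrt (slope tau t))).
Proof.
intros Htau Ht Hf Hg. apply lim_sqrt.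
apply (lim_comp2 slope f g); [now apply slope_continuous | easy | easy].
Qed.

Lemma sqrt_slope_pos tau t : 0 < tau -> - tau < t -> 0 < sqrt (slope tau t).
Proof. intros. now apply sqrt_lt_R0, slope_pos. Qed.

(** * The desingularized integrals *)

(** The integrand of the length [rho] after the substitution, stripped of its factor
    [sqrt (tau - s)]. *)
Definition Yintegrand (p : R * R) (u : R) : R :=
  2 * aext a (sub (fst p) (snd p) u) / sqrt (slope (fst p) (sub (fst p) (snd p) u)).

Definition Yint (tau s : R) : R := RInt (Yintegrand (tau, s)) 0 1.

Lemma Yintegrand_continuous tau s u : 0 < tau -> - tau < s -> 0 <= u <= 1 ->
  continuous (fun z : R * R * R => Yintegrand (fst z) (snd z)) (tau, s, u).
Proof.
intros Htau Hs Hu. apply continuous_lim. unfold Yintegrand. cbn [fst snd].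
assert (Hgt := sub_gt tau s u (- tau) ltac:(lra) ltac:(lra) ltac:(lra)).
assert (Hsub : filterlim (fun z : R * R * R => sub (fst (fst z)) (snd (fst z)) (snd z))
  (locally (tau, s, u)) (locally (sub tau s u)))
  by (apply lim_sub; [apply lim_triple1 | apply lim_triple2 | apply lim_triple3]).
apply lim_div; [apply Rgt_not_eq; now apply sqrt_slope_pos | |].
- apply lim_mult; [apply filterlim_const | now apply (lim_comp (aext a)); [apply aext_continuous |]].
- apply lim_slope; try easy. apply lim_triple1.
Qed.

Lemma locally_domain (tau s : R) : 0 < tau -> - tau < s ->
  locally (tau, s) (fun q : R * R => 0 < fst q /\ - fst q < snd q).
Proof.
intros Htau Hs.
assert (Hd : 0 < Rmin tau ((tau + s) / 2)) by (apply Rmin_pos; lra).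
exists (mkposreal _ Hd). intros [x y] [Hx Hy]; cbn [fst snd] in *.
apply Rabs_lt_between' in Hx, Hy. cbn [pos] in Hx, Hy.
assert (H1 := Rmin_l tau ((tau + s) / 2)). assert (H2 := Rmin_r tau ((tau + s) / 2)). lra.
Qed.

Lemma Yint_continuous tau s : 0 < tau -> - tau < s ->
  continuous (fun p => Yint (fst p) (snd p)) (tau, s).
Proof.
intros Htau Hs.
apply (continuous_ext (fun p => RInt (Yintegrand p) 0 1)); [now intros [x y] |].
apply RInt_param_continuous.
generalize (locally_domain tau s Htau Hs). apply filter_imp.
intros [x y] [Hx Hy] u Hu. now apply Yintegrand_continuous.
Qed.

(** * The integral [chi] multiplied by the scale factor *)

(** The cap at [1] is inactive for [0 <= s <= t] with [t > 0], and keeps the quotient bounded when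
    the arguments leave that range. At [t = 0] the value is [0], by the convention that the inverse
    of [0] is [0]. *)
Definition ratio (s t : R) : R := Rmin 1 (aext a s / aext a t).

Lemma ratio_bound s t : 0 <= ratio s t <= 1.
Proof.
unfold ratio. split; [| apply Rmin_l]. apply Rmin_glb; [lra |].
destruct (Req_dec t 0) as [-> | Ht].
- unfold Rdiv. rewrite aext_0, Rinv_0. lra.
- apply Rmult_le_pos; [apply aext_nonneg | apply Rlt_le, Rinv_0_lt_compat, aext_pos, Ht].
Qed.

Lemma ratio_eq s t : 0 <= s <= t -> 0 < t -> ratio s t = aext a s / aext a t.
Proof.
intros [Hs Ht] Ht0. unfold ratio. apply Rmin_right.
assert (Hp := aext_pos t ltac:(lra)).
apply Rle_div_l; [easy |]. rewrite Rmult_1_l.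
destruct (Rle_lt_or_eq_dec s t Ht) as [H | ->]; [| lra].
apply Rlt_le, aext_incr. now rewrite !Rabs_pos_eq by lra.
Qed.

Lemma lim_aext {T} {F : (T -> Prop) -> Prop} {FF : Filter F} (f : T -> R) l :
  filterlim f F (locally l) -> filterlim (fun x => aext a (f x)) F (locally (aext a l)).
Proof. apply lim_comp, aext_continuous. Qed.

Lemma lim_ratio {T} {F : (T -> Prop) -> Prop} {FF : Filter F} (f g : T -> R) s t :
  t <> 0 -> filterlim f F (locally s) -> filterlim g F (locally t) ->
  filterlim (fun x => ratio (f x) (g x)) F (locally (ratio s t)).
Proof.
intros Ht Hf Hg. unfold ratio.
apply lim_min; [apply filterlim_const |].
apply lim_div; [apply Rgt_not_eq, aext_pos, Ht | |]; now apply lim_aext.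
Qed.

(* [u = v (2 - v)] adds the factor [2 (1 - v)], which kills the discontinuity of
   [ratio] at the origin, reached only for [s = 0] and [v = 1]. *)
Definition Xintegrand (p : R * R) (v : R) : R :=
  2 * (1 - v) *
  (2 * ratio (snd p) (sub (fst p) (Rabs (snd p)) (v * (2 - v))) *
   (aext a (fst p) / sqrt (slope (fst p) (sub (fst p) (Rabs (snd p)) (v * (2 - v)))))).

Definition Xint (tau s : R) : R := RInt (Xintegrand (tau, s)) 0 1.

Lemma Xintegrand_continuous tau s v : 0 < tau -> 0 <= v <= 1 ->
  continuous (fun z : R * R * R => Xintegrand (fst z) (snd z)) (tau, s, v).
Proof.
intros Htau Hv. apply continuous_lim. unfold Xintegrand. cbn [fst snd].
assert (Hs := Rabs_pos s).
assert (Hw : 0 <= v * (2 - v) <= 1) by nra.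
assert (Hgt : - tau < sub tau (Rabs s) (v * (2 - v))) by (apply sub_gt; lra).
assert (Hsub : filterlim (fun z : R * R * R =>
   sub (fst (fst z)) (Rabs (snd (fst z))) (snd z * (2 - snd z)))
  (locally (tau, s, v)) (locally (sub tau (Rabs s) (v * (2 - v))))).
{ apply lim_sub; [apply lim_triple1 | apply lim_abs, lim_triple2 |].
  apply lim_mult; [apply lim_triple3 | apply lim_minus; [apply filterlim_const | apply lim_triple3]]. }
assert (Hsl : filterlim (fun z : R * R * R => aext a (fst (fst z)) / sqrt (slope (fst (fst z))
     (sub (fst (fst z)) (Rabs (snd (fst z))) (snd z * (2 - snd z)))))
   (locally (tau, s, v)) (locally (aext a tau / sqrt (slope tau (sub tau (Rabs s) (v * (2 - v))))))).
{ apply lim_div; [apply Rgt_not_eq; now apply sqrt_slope_pos | |].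
  - apply lim_aext, lim_triple1.
  - apply lim_slope; try easy. apply lim_triple1. }
assert (Hv1 : filterlim (fun z : R * R * R => 2 * (1 - snd z)) (locally (tau, s, v)) (locally (2 * (1 - v)))).
{ apply lim_mult; [apply filterlim_const |]. apply lim_minus; [apply filterlim_const | apply lim_triple3]. }
(* For [v < 1] the point [sub] is positive even if [s = 0], so [ratio] is continuous there. At
   [v = 1] only the boundedness of [ratio] is used, against the factor [2 (1 - v)] that tends to
   [0]. *)
destruct (Rle_lt_or_eq_dec v 1 (proj2 Hv)) as [Hlt | ->].
- apply lim_mult; [exact Hv1 |]. apply lim_mult; [| exact Hsl].
  apply lim_mult; [apply filterlim_const |].
  apply lim_ratio; [| apply lim_triple2 | exact Hsub].
  apply Rgt_not_eq. unfold sub.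
  assert (0 < (1 - v) * (1 - v)) by (apply Rmult_lt_0_compat; lra).
  assert (0 <= v * (2 - v) < 1) by lra. set (w := v * (2 - v)) in *.
  assert (0 <= w ^ 2 < 1) by nra. set (w2 := w ^ 2) in *. nra.
- match goal with |- filterlim _ _ (locally (2 * (1 - 1) * ?X)) =>
    replace (2 * (1 - 1) * X) with 0 by ring end.
  eapply lim_bound0.
  2: { replace 0 with (Rabs (2 * (1 - 1)) * (2 * Rabs (aext a tau / sqrt (slope tau (sub tau (Rabs s) (1 * (2 - 1))))))).
       - apply lim_mult; [apply lim_abs, Hv1 |]. apply lim_mult; [apply filterlim_const |].
         apply lim_abs, Hsl.
       - replace (2 * (1 - 1)) with 0 by ring. rewrite Rabs_R0. ring. }
  apply filter_forall. intros z. rewrite !Rabs_mult.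
  apply Rmult_le_compat_l; [rewrite <- Rabs_mult; apply Rabs_pos |].
  apply Rmult_le_compat_r; [apply Rabs_pos |].
  rewrite (Rabs_pos_eq 2), (Rabs_pos_eq (ratio _ _)); [| apply ratio_bound | lra].
  rewrite <- (Rmult_1_r 2) at 3. apply Rmult_le_compat_l; [lra | apply ratio_bound].
Qed.

Lemma Xint_continuous tau s : 0 < tau ->
  continuous (fun p => Xint (fst p) (snd p)) (tau, s).
Proof.
intros Htau.
apply (continuous_ext (fun p => RInt (Xintegrand p) 0 1)); [now intros [x y] |].
apply RInt_param_continuous.
apply (filter_imp (fun q : R * R => ball tau (mkposreal _ Htau) (fst q)));
  [| exact (lim_pair1 tau s _ (locally_ball tau (mkposreal _ Htau)))].
intros [x y] Hx u Hu.
apply Rabs_lt_between' in Hx. cbn in Hx.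
apply Xintegrand_continuous; [lra | easy].
Qed.

Lemma Xint_abs tau s : Xint tau (Rabs s) = Xint tau s.
Proof.
unfold Xint. apply RInt_ext_01. intros v _. unfold Xintegrand, ratio; cbn [fst snd].
unfold aext at 1 5. rewrite !Rabs_Rabsolu. reflexivity.
Qed.

(** For [s > 0] the variable [t] stays away from [0], so the quadratic substitution gives a
    continuous integrand. The change [u = v (2 - v)] follows, and multiplication by [a(s)] produces
    the quotient [ratio]. At [s = tau] both sides vanish. *)
Lemma chi_eq tau s : 0 < s <= tau -> aext a s * chi a s tau = sqrt (tau - s) * Xint tau s.
Proof.
intros [Hs Hst]. unfold chi.
destruct (Rle_lt_or_eq_dec s tau Hst) as [Hlt | ->];
  [| rewrite Iimp_degenerate, Rminus_diag, sqrt_0; ring].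
pose (N u := sqrt (tau - s) * (2 * (aext a tau / aext a (sub tau s u)) / sqrt (slope tau (sub tau s u)))).
assert (HN : forall u, 0 <= u <= 1 -> continuous N u).
{ intros u Hu. apply continuous_lim. unfold N.
  assert (Hgt := sub_gt tau s u 0 ltac:(lra) ltac:(lra) Hu).
  assert (Hsub : filterlim (sub tau s) (locally u) (locally (sub tau s u)))
    by (apply lim_sub; try apply filterlim_const; apply filterlim_id).
  apply lim_mult; [apply filterlim_const |].
  apply lim_div; [apply Rgt_not_eq, sqrt_slope_pos; lra | |].
  - apply lim_mult; [apply filterlim_const |].
    apply lim_div; [apply Rgt_not_eq, aext_pos; lra | apply filterlim_const | now apply lim_aext].
  - apply lim_slope; [lra | lra | apply filterlim_const | easy]. }
rewrite (Iimp_subst _ N s tau Hlt); [| | exact HN |].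
- rewrite <- (RInt_double_speed N HN), <- RInt_mult_l.
  + unfold Xint. rewrite <- RInt_mult_l.
    * apply RInt_ext_01. intros v Hv.
      unfold N, Xintegrand; cbn [fst snd]. rewrite (Rabs_pos_eq s) by lra.
      rewrite ratio_eq.
      -- unfold Rdiv. ring.
      -- split; [lra |]. apply sub_between; nra.
      -- apply sub_gt; nra.
    * intros v Hv. apply continuous_slice. apply Xintegrand_continuous; lra.
  + intros v Hv. apply continuous_lim, lim_mult.
    * apply lim_mult; [apply filterlim_const |]. apply lim_minus; [apply filterlim_const | apply filterlim_id].
    * apply (lim_comp N); [apply HN; nra |].
      apply lim_mult; [apply filterlim_id |]. apply lim_minus; [apply filterlim_const | apply filterlim_id].
- intros t Ht.
  apply (continuous_ext_loc _ (fun t => / aext a t * (a tau * / sqrt (aext a tau ^ 2 - aext a t ^ 2)))).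
  + exists (mkposreal t ltac:(lra)). intros x Hx. apply Rabs_lt_between' in Hx. cbn in Hx.
    rewrite (aext_pos_eq x), (aext_pos_eq tau) by lra. reflexivity.
  + apply continuous_lim. apply lim_mult.
    * apply lim_inv; [apply Rgt_not_eq, aext_pos; lra | apply aext_continuous].
    * apply lim_mult; [apply filterlim_const | apply kernel_continuous; lra].
- intros u Hu. fold (sub tau s u).
  assert (Hgt := sub_gt tau s u 0 ltac:(lra) ltac:(lra) ltac:(lra)).
  rewrite <- (aext_pos_eq (sub tau s u)), <- (aext_pos_eq tau) by lra.
  transitivity (/ aext a (sub tau s u) * aext a tau *
     (2 * sqrt (tau - s) / sqrt (slope tau (sub tau s u)))).
  + unfold N, Rdiv. ring.
  + rewrite <- kernel_subst by lra. unfold Rdiv. ring.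
Qed.

(** At [s = tau] the parametrization is constant, so the integral is explicit. [Xint] takes the same
    value there, which later forces [lambda0 rho^2] to tend to [0]. *)
Lemma Yint_diag tau : 0 < tau -> Yint tau tau = 2 * a tau / sqrt (slope tau tau).
Proof.
intros Htau. unfold Yint. rewrite (RInt_ext_01 _ (fun _ => 2 * a tau / sqrt (slope tau tau))).
- apply RInt_const_01.
- intros u _. unfold Yintegrand; cbn [fst snd].
  replace (sub tau tau u) with tau by (unfold sub; ring). now rewrite aext_pos_eq by lra.
Qed.

Lemma Xint_diag tau : 0 < tau -> Xint tau tau = 2 * a tau / sqrt (slope tau tau).
Proof.
intros Htau. unfold Xint.
rewrite (RInt_ext_01 _ (fun v => 2 * (1 - v) * (2 * a tau / sqrt (slope tau tau)))).
- rewrite (RInt_double_speed (fun _ => 2 * a tau / sqrt (slope tau tau))).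
  + apply RInt_const_01.
  + intros u _. apply continuous_const.
- intros u _. unfold Xintegrand; cbn [fst snd]. rewrite (Rabs_pos_eq tau) by lra.
  replace (sub tau tau (u * (2 - u))) with tau by (unfold sub; ring).
  rewrite ratio_eq by lra. rewrite aext_pos_eq by lra.
  assert (H := aext_pos tau ltac:(lra)). rewrite aext_pos_eq in H by lra.
  assert (H' := sqrt_slope_pos tau tau Htau ltac:(lra)). field. lra.
Qed.

(** The quantity [a(s)^2 chi^2] freed from the improper integral, hence meaningful at [s = 0] as
    well. *)
Definition area (tau s : R) : R := (tau - Rabs s) * Xint tau s ^ 2.

Lemma area_continuous tau s : 0 < tau -> continuous (fun p => area (fst p) (snd p)) (tau, s).
Proof.
intros Htau. apply continuous_lim. unfold area. apply lim_mult.
- apply lim_minus; [apply lim_pair1 | apply lim_abs, lim_pair2].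
- apply lim_pow. exact (Xint_continuous tau s Htau).
Qed.

Lemma area_chi tau s : 0 < Rabs s <= tau -> aext a s ^ 2 * chi a (Rabs s) tau ^ 2 = area tau s.
Proof.
intros Hs. unfold area.
assert (E := chi_eq tau (Rabs s) Hs).
replace (aext a (Rabs s)) with (aext a s) in E by (unfold aext; now rewrite Rabs_Rabsolu).
rewrite <- Rpow_mult_distr, E, Xint_abs, Rpow_mult_distr, pow2_sqrt by lra. reflexivity.
Qed.

(** At [t0 = 0] the coefficient is defined as a limit; [area] is continuous there, so the limit is
    its value. *)
Lemma g_thth_eq tau rho : - tau < t0fun a tau rho <= tau -> g_thth a tau rho = area tau (t0fun a tau rho).
Proof.
intros Ht. unfold g_thth. set (s := t0fun a tau rho) in *.
assert (Htau : 0 < tau) by lra.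
destruct (Req_EM_T s 0) as [-> | Hs].
- replace (area tau 0) with (real (Finite (area tau 0))) by reflexivity.
  f_equal. apply is_lim_unique.
  apply (is_lim_ext_loc (fun s => area tau s)).
  + exists (mkposreal _ Htau). intros x Hx Hx0. symmetry. apply area_chi.
    apply Rabs_lt_between' in Hx. cbn in Hx. split; [now apply Rabs_pos_lt |].
    apply Rabs_le. lra.
  + assert (H : filterlim (fun s => area tau s) (locally 0) (locally (area tau 0))).
    { apply (lim_comp2 area (fun _ => tau) (fun s => s)); [now apply area_continuous | apply filterlim_const | apply filterlim_id]. }
    eapply filterlim_filter_le_1; [| exact H].
    apply filter_le_within.
- apply area_chi. split; [now apply Rabs_pos_lt | apply Rabs_le; lra].
Qed.

(** * The function f *)

Context (K : R) (HK : 1 <= K)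
  (Hlow : forall t, 0 < t -> - K <= a t * add a t / (ad a t) ^ 2).

(** The quotient [a'' / a'^2] may be unbounded near [0]; the factor [a^2] tames it. *)
Definition weight (t : R) : R := aext a t ^ 2 * (add a (Rabs t) / ad a (Rabs t) ^ 2).

(** Both regularity bounds enter: [- K <= a a'' / a'^2 <= 1 <= K], multiplied by [a]. *)
Lemma weight_bound t : Rabs (weight t) <= K * aext a t.
Proof.
unfold weight. destruct (Req_dec t 0) as [-> | Ht].
- rewrite aext_0. replace (0 ^ 2 * _) with 0 by ring. rewrite Rabs_R0. lra.
- assert (Hp := Rabs_pos_lt t Ht).
  destruct Ha as (_ & _ & _ & _ & _ & Hup).
  destruct (Hup _ Hp) as [_ H1]. assert (H2 := Hlow _ Hp).
  fold (aext a t) in H1, H2.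
  replace (aext a t ^ 2 * (add a (Rabs t) / ad a (Rabs t) ^ 2))
    with (aext a t * (aext a t * add a (Rabs t) / ad a (Rabs t) ^ 2)) by (unfold Rdiv; ring).
  rewrite Rabs_mult, (Rabs_pos_eq (aext a t)) by apply aext_nonneg.
  rewrite Rmult_comm. apply Rmult_le_compat_r; [apply aext_nonneg |].
  apply Rabs_le. lra.
Qed.

Lemma add_quot_continuous t : 0 < t -> continuous (fun t => add a t / ad a t ^ 2) t.
Proof.
intros Ht. apply continuous_lim. apply lim_div.
- apply pow_nonzero, Rgt_not_eq, ad_pos, Ht.
- destruct Ha as (_ & _ & _ & _ & Hd & _). apply (Hd t Ht).
- apply lim_pow. now apply ad_continuous.
Qed.

(* For [0 <= s <= t] and [0 < t] this is [(a'' / a'^2)(t) (a(t)^2 - a(s)^2)]. *)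
Definition Gfun (s t : R) : R := weight t * (1 - ratio s t ^ 2).

(** At [t = 0] the bound [|G| <= K a(t)] forces the limit [0], whatever [ratio] does there.
    Elsewhere every factor is continuous. *)
Lemma Gfun_continuous s t : continuous (fun p => Gfun (fst p) (snd p)) (s, t).
Proof.
apply continuous_lim. unfold Gfun. cbn [fst snd].
destruct (Req_dec t 0) as [-> | Ht].
- assert (E : weight 0 * (1 - ratio s 0 ^ 2) = 0).
  { unfold weight. rewrite aext_0. ring. }
  rewrite E.
  apply (lim_bound0 _ (fun p => K * aext a (snd p))).
  + apply filter_forall. intros [x y]; cbn [fst snd].
    rewrite Rabs_mult. assert (Hw := weight_bound y). assert (Hr := ratio_bound x y).
    assert (0 <= ratio x y ^ 2 <= 1) by nra.
    rewrite (Rabs_pos_eq (1 - _)) by lra.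
    assert (Hp := Rabs_pos (weight y)). nra.
  + assert (L : filterlim (fun p : R * R => K * aext a (snd p)) (locally (s, 0)) (locally (K * aext a 0))).
    { apply lim_mult; [apply filterlim_const |]. apply lim_aext, lim_pair2. }
    now rewrite aext_0, Rmult_0_r in L.
- apply lim_mult.
  + unfold weight. apply lim_mult.
    * apply lim_pow, lim_aext, lim_pair2.
    * apply (lim_comp (fun t => add a t / ad a t ^ 2)).
      -- apply add_quot_continuous. now apply Rabs_pos_lt.
      -- apply lim_abs, lim_pair2.
  + apply lim_minus; [apply filterlim_const |]. apply lim_pow.
    apply lim_ratio; [easy | apply lim_pair1 | apply lim_pair2].
Qed.

(** The integrand of [f] after the substitution. Rationalizing the difference of the two square
    roots brings out [a(t)^2 - a(s)^2], contained in [Gfun], and all powers of [tau - s] and all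
    singular powers of [u] cancel. *)
Definition Fintegrand (p : R * R) (u : R) : R :=
  2 * Gfun (snd p) (sub (fst p) (snd p) u) /
  (sqrt (slope (fst p) (sub (fst p) (snd p) u)) *
   (sqrt (slope (fst p) (snd p)) + u * sqrt (slope (fst p) (sub (fst p) (snd p) u)))).

Definition Fint (tau s : R) : R := RInt (Fintegrand (tau, s)) 0 1.

Lemma Fintegrand_continuous tau s u : 0 < tau -> - tau < s -> 0 <= u <= 1 ->
  continuous (fun z : R * R * R => Fintegrand (fst z) (snd z)) (tau, s, u).
Proof.
intros Htau Hs Hu. apply continuous_lim. unfold Fintegrand. cbn [fst snd].
assert (Hgt := sub_gt tau s u (- tau) ltac:(lra) ltac:(lra) ltac:(lra)).
assert (Hsub : filterlim (fun z : R * R * R => sub (fst (fst z)) (snd (fst z)) (snd z))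
  (locally (tau, s, u)) (locally (sub tau s u)))
  by (apply lim_sub; [apply lim_triple1 | apply lim_triple2 | apply lim_triple3]).
assert (H1 := sqrt_slope_pos tau (sub tau s u) Htau Hgt).
assert (H2 := sqrt_slope_pos tau s Htau Hs).
assert (L := lim_slope _ _ tau _ Htau Hgt (lim_triple1 tau s u) Hsub).
apply lim_div.
- assert (0 < sqrt (slope tau s) + u * sqrt (slope tau (sub tau s u))) by nra.
  apply Rgt_not_eq. now apply Rmult_lt_0_compat.
- apply lim_mult; [apply filterlim_const |].
  apply (lim_comp2 Gfun (fun z : R * R * R => snd (fst z))); [apply Gfun_continuous | apply lim_triple2 | easy].
- apply lim_mult; [exact L |]. apply lim_plus.
  + exact (lim_slope _ _ tau s Htau Hs (lim_triple1 tau s u) (lim_triple2 tau s u)).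
  + apply lim_mult; [apply lim_triple3 | exact L].
Qed.

Lemma Fint_continuous tau s : 0 < tau -> - tau < s ->
  continuous (fun p => Fint (fst p) (snd p)) (tau, s).
Proof.
intros Htau Hs.
apply (continuous_ext (fun p => RInt (Fintegrand p) 0 1)); [now intros [x y] |].
apply RInt_param_continuous.
generalize (locally_domain tau s Htau Hs). apply filter_imp.
intros [x y] [Hx Hy] u Hu. now apply Fintegrand_continuous.
Qed.

Lemma fpos_eq tau s : 0 < tau -> 0 <= s <= tau -> fpos a tau s = Fint tau s.
Proof.
intros Htau [Hs Hst]. unfold fpos.
destruct (Rle_lt_or_eq_dec s tau Hst) as [Hlt | ->].
- apply Iimp_subst; [easy | | |].
  + intros t Ht. apply continuous_lim. apply lim_mult; [apply add_quot_continuous; lra |].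
    apply lim_minus; [| apply filterlim_const].
    apply lim_mult; [apply filterlim_const |].
    assert (H := kernel_continuous tau t Htau ltac:(lra)).
    change (continuous (fun x => / sqrt (a tau ^ 2 - a x ^ 2)) t).
    apply (continuous_ext_loc _ (fun t => / sqrt (aext a tau ^ 2 - aext a t ^ 2))); [| exact H].
    exists (mkposreal t ltac:(lra)). intros x Hx. apply Rabs_lt_between' in Hx. cbn in Hx.
    now rewrite !aext_pos_eq by lra.
  + intros u Hu. apply continuous_slice. apply Fintegrand_continuous; lra.
  + intros u Hu. fold (sub tau s u). set (t := sub tau s u).
    assert (Ht : s < t < tau) by now apply sub_between_strict.
    rewrite <- (aext_pos_eq tau), <- (aext_pos_eq s), <- (aext_pos_eq t) by lra.
    rewrite !slope_eq.
    replace (tau - t) with ((tau - s) * u ^ 2) by (unfold t, sub; ring).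
    assert (Hq1 := slope_pos tau s Htau ltac:(lra)).
    assert (Hq2 := slope_pos tau t Htau ltac:(lra)).
    rewrite !sqrt_mult by nra. rewrite sqrt_pow2 by lra.
    assert (P1 := sqrt_lt_R0 (tau - s) ltac:(lra)).
    assert (P2 := sqrt_lt_R0 _ Hq1). assert (P3 := sqrt_lt_R0 _ Hq2).
    assert (E1 := sqrt_sqrt (tau - s) ltac:(lra)).
    assert (E2 := sqrt_sqrt _ (Rlt_le _ _ Hq1)). assert (E3 := sqrt_sqrt _ (Rlt_le _ _ Hq2)).
    (* Here [a(t)^2 - a(s)^2] is read as the difference of the slope identities at [s] and at
       [t]. *)
    assert (EG : Gfun s t = add a t / ad a t ^ 2 *
       ((tau - s) * (sqrt (slope tau s) ^ 2 - u ^ 2 * sqrt (slope tau t) ^ 2))).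
    { assert (Hat := aext_pos t ltac:(lra)).
      unfold Gfun, weight. rewrite ratio_eq, (Rabs_pos_eq t) by lra.
      transitivity (add a t / ad a t ^ 2 *
         ((aext a tau ^ 2 - aext a s ^ 2) - (aext a tau ^ 2 - aext a t ^ 2))).
      - assert (Had := ad_pos t ltac:(lra)). field. lra.
      - rewrite !slope_eq. replace (tau - t) with ((tau - s) * u ^ 2) by (unfold t, sub; ring).
        rewrite <- E2 at 1. rewrite <- E3 at 1. ring. }
    unfold Fintegrand; cbn [fst snd]. fold t. rewrite EG.
    set (h := add a t / ad a t ^ 2). set (p := sqrt (slope tau s)) in *.
    set (q := sqrt (slope tau t)) in *. set (r := sqrt (tau - s)) in *.
    rewrite <- E1. field. assert (0 < p + u * q) by nra. lra.
(* For [s = tau] the improper integral is [0] by definition, and the integrand vanishes because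
   [ratio tau tau = 1]. *)
- rewrite Iimp_degenerate. unfold Fint. symmetry.
  rewrite (RInt_ext_01 _ (fun _ => 0)); [apply RInt_const_01 |].
  intros u _. unfold Fintegrand, Gfun; cbn [fst snd].
  replace (sub tau tau u) with tau by (unfold sub; ring).
  rewrite ratio_eq by lra. assert (H := aext_pos tau ltac:(lra)).
  replace (aext a tau / aext a tau) with 1 by (field; lra). unfold Rdiv. ring.
Qed.

(** A single formula for both signs of [t0]: the bracket cancels for [s >= 0], and the first term
    becomes [Fint tau 0] for [s <= 0]. Continuity across [s = 0] is then immediate. *)
Definition Ffun (tau s : R) : R := Fint tau (Rmax s 0) + (Fint tau 0 - Fint tau (Rmax (- s) 0)).

Lemma ffun_eq tau s : - tau < s <= tau -> ffun a tau s = Ffun tau s.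
Proof.
intros Hs. unfold ffun, Ffun. destruct (Rle_dec 0 s) as [H | H].
- rewrite fpos_eq by lra. rewrite Rmax_left, (Rmax_right (- s)) by lra. ring.
- rewrite !fpos_eq by lra. rewrite Rmax_right, (Rmax_left (- s)) by lra. ring.
Qed.

Lemma Ffun_continuous tau s : - tau < s <= tau ->
  continuous (fun p => Ffun (fst p) (snd p)) (tau, s).
Proof.
intros Hs. apply continuous_lim. unfold Ffun. cbn [fst snd].
assert (L : forall (f : R * R -> R) l, - tau < l -> filterlim f (locally (tau, s)) (locally l) ->
  filterlim (fun p => Fint (fst p) (f p)) (locally (tau, s)) (locally (Fint tau l))).
{ intros f l Hl Hf. apply (lim_comp2 Fint fst f); [apply Fint_continuous; lra | apply lim_pair1 | easy]. }
apply lim_plus; [| apply lim_minus]; apply L.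
- apply Rlt_le_trans with s; [lra | apply Rmax_l].
- apply lim_max; [apply lim_pair2 | apply filterlim_const].
- lra.
- apply filterlim_const.
- apply Rlt_le_trans with 0; [lra | apply Rmax_r].
- apply lim_max; [apply lim_opp, lim_pair2 | apply filterlim_const].
Qed.

(** * Proper length and its inverse t0 *)

Definition rho_int (tau s : R) : R := sqrt (tau - s) * Yint tau s.

Lemma rho_int_continuous tau s : 0 < tau -> - tau < s ->
  continuous (fun p => rho_int (fst p) (snd p)) (tau, s).
Proof.
intros Htau Hs. apply continuous_lim. unfold rho_int. apply lim_mult.
- apply lim_sqrt, lim_minus; [apply lim_pair1 | apply lim_pair2].
- exact (Yint_continuous tau s Htau Hs).
Qed.

Lemma rho_int_diag tau : rho_int tau tau = 0.
Proof. unfold rho_int. rewrite Rminus_diag, sqrt_0. ring. Qed.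

Definition kernel (tau t : R) : R := aext a t / sqrt (aext a tau ^ 2 - aext a t ^ 2).

Lemma aext_kernel_continuous tau t : - tau < t < tau -> continuous (kernel tau) t.
Proof.
intros Ht. apply continuous_lim. apply lim_mult; [apply aext_continuous |].
apply kernel_continuous; lra.
Qed.

(** The filter at the lower end is left general: [at_right] matches the definition of the length,
    [at_point] gives additivity over intervals. *)
Lemma rho_int_RInt_gen (Fa : (R -> Prop) -> Prop) {FFa : Filter Fa} tau s : - tau < s < tau ->
  filter_le Fa (locally s) -> Fa (fun x => s <= x < tau) ->
  is_RInt_gen (kernel tau) Fa (at_left tau) (rho_int tau s).
Proof.
intros Hs HFa HFa'.
assert (Htau : 0 < tau) by lra.
assert (HN : forall u, 0 <= u <= 1 -> continuous (Yintegrand (tau, s)) u).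
{ intros u Hu. apply continuous_slice, Yintegrand_continuous; lra. }
unfold rho_int, Yint. rewrite <- RInt_mult_l by exact HN.
apply is_RInt_gen_subst with (lo := s); [easy | lra | easy | | | |].
- revert HFa'. apply filter_imp. intros x Hx. split; [easy | apply aext_kernel_continuous; lra].
- intros t Ht. apply aext_kernel_continuous. lra.
- intros u Hu. apply continuous_lim, lim_mult; [apply filterlim_const | now apply HN].
- intros u Hu. fold (sub tau s u). unfold kernel.
  transitivity (aext a (sub tau s u) * (2 * sqrt (tau - s) / sqrt (slope tau (sub tau s u)))).
  + unfold Yintegrand, Rdiv; cbn [fst snd]. ring.
  + rewrite <- kernel_subst by lra. unfold Rdiv. ring.
Qed.

Lemma rho_of_eq tau s : - tau < s <= tau -> rho_of a tau s = rho_int tau s.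
Proof.
intros Hs. unfold rho_of, Iimp. destruct (Rle_dec tau s) as [H | H].
- replace s with tau by lra. now rewrite rho_int_diag.
- apply is_RInt_gen_unique.
  replace (a tau) with (aext a tau) by (apply aext_pos_eq; lra).
  apply (rho_int_RInt_gen _); [lra | apply filter_le_within |].
  assert (Hpos : 0 < tau - s) by lra.
  exists (mkposreal _ Hpos). intros x Hx Hx'. apply Rabs_lt_between' in Hx. simpl in Hx. lra.
Qed.

Lemma rho_int_Chasles tau s1 s2 : - tau < s1 <= s2 -> s2 < tau ->
  rho_int tau s1 = RInt (kernel tau) s1 s2 + rho_int tau s2.
Proof.
intros Hs1 Hs2.
assert (Hpt : forall s, - tau < s < tau ->
  is_RInt_gen (kernel tau) (at_point s) (at_left tau) (rho_int tau s)).
{ intros s Hs. apply (rho_int_RInt_gen _); [easy | |].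
  - intros P HP. exact (locally_singleton _ _ HP).
  - unfold at_point. lra. }
assert (H1 := Hpt s1 ltac:(lra)).
assert (H0 : is_RInt_gen (kernel tau) (at_point s1) (at_point s2) (RInt (kernel tau) s1 s2)).
{ apply is_RInt_gen_at_point, (RInt_correct (V := R_CompleteNormedModule)).
  apply (ex_RInt_continuous (V := R_CompleteNormedModule)). intros t.
  rewrite Rmin_left, Rmax_right by lra. intros Ht. apply aext_kernel_continuous. lra. }
assert (H2 := is_RInt_gen_Chasles (V := R_NormedModule) (Fa := at_point s1) (Fc := at_left tau)
  _ _ _ _ H0 (Hpt s2 ltac:(lra))).
rewrite <- (is_RInt_gen_unique _ _ H1). exact (is_RInt_gen_unique _ _ H2).
Qed.

Lemma Yint_pos tau s : 0 < tau -> 0 <= s <= tau -> 0 < Yint tau s.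
Proof.
intros Htau Hs. unfold Yint. apply RInt_gt_0; [lra | |].
- intros u Hu. assert (Ht : 0 < sub tau s u).
  { unfold sub. assert (0 < u ^ 2 < 1) by (split; nra). set (w := u ^ 2) in *. nra. }
  unfold Yintegrand; cbn [fst snd]. apply Rdiv_lt_0_compat; [| apply sqrt_slope_pos; lra].
  assert (H := aext_pos (sub tau s u) ltac:(lra)). lra.
- intros u Hu. apply continuous_slice, Yintegrand_continuous; lra.
Qed.

(** The kernel is even, so the integrals over [[- s, 0]] and [[0, s]] agree. This reflection carries
    monotonicity and surjectivity from [s >= 0] to [s < 0]. *)
Lemma rho_int_even tau s : 0 < tau -> Rabs s < tau -> rho_int tau (- s) = 2 * rho_int tau 0 - rho_int tau s.
Proof.
assert (W : forall s, 0 <= s < tau -> rho_int tau (- s) = 2 * rho_int tau 0 - rho_int tau s).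
{ intros x Hx.
  assert (E1 := rho_int_Chasles tau (- x) 0 ltac:(lra) ltac:(lra)).
  assert (E2 := rho_int_Chasles tau 0 x ltac:(lra) ltac:(lra)).
  assert (E3 : RInt (kernel tau) (- x) 0 = RInt (kernel tau) 0 x).
  { apply is_RInt_unique.
    assert (H : is_RInt (kernel tau) 0 x (RInt (kernel tau) 0 x)).
    { apply (RInt_correct (V := R_CompleteNormedModule)), (ex_RInt_continuous (V := R_CompleteNormedModule)).
      intros t. rewrite Rmin_left, Rmax_right by lra. intros Ht. apply aext_kernel_continuous. lra. }
    apply is_RInt_swap in H.
    replace x with (- - x) in H at 1 by ring. replace 0 with (- 0) in H at 1 by ring.
    apply is_RInt_comp_opp, is_RInt_opp in H.
    rewrite opp_opp in H. revert H. apply is_RInt_ext.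
    intros t _. rewrite opp_opp. unfold kernel, aext. now rewrite Rabs_Ropp. }
  lra. }
intros Htau Hs. destruct (Rle_dec 0 s) as [H | H].
- apply W. rewrite Rabs_pos_eq in Hs; lra.
- rewrite Rabs_left in Hs by lra. assert (E := W (- s) ltac:(lra)). rewrite Ropp_involutive in E. lra.
Qed.

Lemma rho_int_decr_pos tau s1 s2 : 0 <= s1 < s2 -> s2 <= tau -> rho_int tau s2 < rho_int tau s1.
Proof.
intros Hs Hs2. destruct (Rle_lt_or_eq_dec s2 tau Hs2) as [Hlt | ->].
- rewrite (rho_int_Chasles tau s1 s2) by lra.
  enough (0 < RInt (kernel tau) s1 s2) by lra.
  apply RInt_gt_0; [lra | |].
  + intros t Ht. unfold kernel. apply Rdiv_lt_0_compat; [apply aext_pos; lra |].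
    apply sqrt_lt_R0. rewrite slope_eq. apply Rmult_lt_0_compat; [lra | apply slope_pos; lra].
  + intros t Ht. apply aext_kernel_continuous. lra.
- rewrite rho_int_diag. unfold rho_int. apply Rmult_lt_0_compat.
  + apply sqrt_lt_R0. lra.
  + apply Yint_pos; lra.
Qed.

(** Reflection reduces negative arguments to positive ones. If the signs differ, the value at [0]
    separates the two lengths. *)
Lemma rho_int_decr tau s1 s2 : - tau < s1 < s2 -> s2 <= tau -> rho_int tau s2 < rho_int tau s1.
Proof.
intros Hs1 Hs2. destruct (Rle_dec 0 s1) as [H1 | H1]; [apply rho_int_decr_pos; lra |].
assert (E1 := rho_int_even tau (- s1) ltac:(lra) ltac:(apply Rabs_def1; lra)).
rewrite Ropp_involutive in E1. rewrite E1.
destruct (Rle_dec 0 s2) as [H2 | H2].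
- assert (P1 := rho_int_decr_pos tau 0 (- s1) ltac:(lra) ltac:(lra)).
  destruct (Req_dec s2 0) as [-> | Hne]; [lra |].
  assert (P2 := rho_int_decr_pos tau 0 s2 ltac:(lra) ltac:(lra)). lra.
- assert (E2 := rho_int_even tau (- s2) ltac:(lra) ltac:(apply Rabs_def1; lra)).
  rewrite Ropp_involutive in E2.
  assert (P := rho_int_decr_pos tau (- s2) (- s1) ltac:(lra) ltac:(lra)). lra.
Qed.

Lemma rhoM_eq tau : 0 < tau -> rhoM a tau = rho_int tau 0.
Proof.
intros Htau. unfold rhoM, Iimp. destruct (Rle_dec tau 0) as [H | _]; [lra |].
apply is_RInt_gen_unique.
apply (is_RInt_gen_ext (kernel tau)).
- exists (fun x => 0 < x) (fun x => 0 < x).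
  + exists (mkposreal 1 Rlt_0_1). now intros x _ Hx.
  + exists (mkposreal _ Htau). intros x Hx _. apply Rabs_lt_between' in Hx. simpl in Hx. lra.
  + intros x y Hx Hy t Ht. cbn [fst snd] in Ht.
    assert (0 < t) by (generalize (Rmin_pos x y Hx Hy); lra).
    unfold kernel. now rewrite !aext_pos_eq by lra.
- apply (rho_int_RInt_gen _); [lra | apply filter_le_within |].
  exists (mkposreal _ Htau). intros x Hx Hx'. apply Rabs_lt_between' in Hx. simpl in Hx. lra.
Qed.

(** * The inverse [t0] of the length and its joint continuity *)

(** A common domain for all functions of [(tau, rho)]. It includes [rho = 0] and contains the images
    of both coordinate domains. *)
Definition polar_domain (p : R * R) : Prop := 0 < fst p /\ 0 <= snd p < 2 * rhoM a (fst p).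

Lemma rho_int_onto_pos tau r : 0 < tau -> 0 <= r <= rho_int tau 0 -> exists s, 0 <= s <= tau /\ rho_int tau s = r.
Proof.
intros Htau Hr.
(* Truncation at [0] makes the function continuous on the whole line, as this intermediate value
   theorem requires. *)
destruct (IVT_gen_consistent (fun s => rho_int tau (Rmax 0 s)) 0 tau r) as (s & Hs & E).
- intros s. apply continuous_lim.
  apply (lim_comp2 rho_int (fun _ => tau) (fun s => Rmax 0 s)).
  + apply rho_int_continuous; [easy |]. assert (H := Rmax_l 0 s). lra.
  + apply filterlim_const.
  + apply lim_max; [apply filterlim_const | apply filterlim_id].
- rewrite !Rmax_right by lra. rewrite rho_int_diag, Rmin_right, Rmax_left by lra. easy.
- rewrite Rmin_left, Rmax_right in Hs by lra. rewrite Rmax_right in E by lra. now exists s.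
Qed.

Lemma t0fun_spec tau rho : polar_domain (tau, rho) ->
  - tau < t0fun a tau rho <= tau /\ rho = rho_int tau (t0fun a tau rho).
Proof.
intros [Htau Hrho]; cbn [fst snd] in *. rewrite rhoM_eq in Hrho by easy.
assert (Hex : exists s, - tau < s <= tau /\ rho = rho_int tau s).
{ destruct (Rle_dec rho (rho_int tau 0)) as [H | H].
  - destruct (rho_int_onto_pos tau rho Htau ltac:(lra)) as (s & Hs & E). exists s. split; [lra | easy].
  - destruct (rho_int_onto_pos tau (2 * rho_int tau 0 - rho) Htau ltac:(lra)) as (s & Hs & E).
    (* The strict bound [rho < 2 rhoM] excludes [s = tau], so that [- s > - tau]. *)
    assert (s < tau).
    { destruct (Rle_lt_or_eq_dec s tau ltac:(lra)) as [Hl | ->]; [easy |]. rewrite rho_int_diag in E. lra. }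
    exists (- s). split; [lra |]. rewrite rho_int_even; [lra | easy | apply Rabs_def1; lra]. }
assert (Hu : exists! s : R, - tau < s <= tau /\ rho = rho_of a tau s).
{ destruct Hex as (s & Hs & E). exists s. split; [rewrite rho_of_eq by easy; now split |].
  intros s' [Hs' E']. rewrite rho_of_eq in E' by easy.
  destruct (Rtotal_order s s') as [Hlt | [Heq | Hgt]]; [exfalso | easy | exfalso].
  - assert (P := rho_int_decr tau s s' ltac:(lra) ltac:(lra)). lra.
  - assert (P := rho_int_decr tau s' s ltac:(lra) ltac:(lra)). lra. }
assert (H := iota_correct (V := R_CompleteNormedModule) _ Hu).
change (- tau < t0fun a tau rho <= tau /\ rho = rho_of a tau (t0fun a tau rho)) in H.
destruct H as [H1 H2]. rewrite rho_of_eq in H2 by easy. now split.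
Qed.

(** Inversion of a strictly decreasing function with a parameter: for a fixed [x] just below [t0],
    the inequality [rho_int tau x > rho] persists at nearby [(tau, rho)], and monotonicity keeps the
    new [t0] above [x]. The upper side is symmetric when [t0 < tau]. *)
Lemma t0fun_continuous : continuous_on polar_domain (fun p => t0fun a (fst p) (snd p)).
Proof.
intros [tau rho] Hp. cbn [fst snd].
destruct (t0fun_spec tau rho Hp) as [Hs E]. set (s := t0fun a tau rho) in *.
assert (Htau : 0 < tau) by lra.
set (F := within polar_domain (locally (tau, rho))).
assert (FF : Filter F) by apply within_filter, locally_filter.
assert (L1 : filterlim fst (F) (locally tau)).
{ eapply filterlim_filter_le_1; [apply filter_le_within | apply lim_pair1]. }
assert (L2 : filterlim snd (F) (locally rho)).
{ eapply filterlim_filter_le_1; [apply filter_le_within | apply lim_pair2]. }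
assert (L3 : forall x, - tau < x -> filterlim (fun p => rho_int (fst p) x - snd p)
   (F) (locally (rho_int tau x - rho))).
{ intros x Hx. apply lim_minus; [| exact L2].
  apply (lim_comp2 rho_int fst (fun _ => x)); [now apply rho_int_continuous | exact L1 | apply filterlim_const]. }
assert (Hdom : F polar_domain).
{ unfold F, within. apply filter_forall. now intros x Hx. }
apply filterlim_locally. intros eps. assert (He := cond_pos eps).
assert (Hlow' : F (fun p => s - eps < t0fun a (fst p) (snd p))).
(* The midpoint [(s - tau) / 2] of [- tau] and [s] keeps [x] inside the range of [t0] when [eps] is
   large. *)
{ pose (x := Rmax (s - eps / 2) ((s - tau) / 2)).
  assert (Hx1 : s - eps / 2 <= x) by apply Rmax_l. assert (Hx2 : (s - tau) / 2 <= x) by apply Rmax_r.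
  assert (Hx : - tau < x < s) by (unfold x, Rmax in *; destruct Rle_dec; lra).
  assert (P := rho_int_decr tau x s ltac:(lra) ltac:(lra)).
  assert (Q1 := lim_gt (F := F) _ _ 0 (L3 x ltac:(lra)) ltac:(lra)).
  assert (Q2 := lim_gt (F := F) _ _ (- x) L1 ltac:(lra)).
  assert (Q3 := lim_gt (F := F) _ _ x L1 ltac:(lra)).
  generalize (filter_and (F := F) _ _ Hdom (filter_and (F := F) _ _ Q1 (filter_and (F := F) _ _ Q2 Q3))). apply filter_imp.
  intros [y r] (Hd & H1 & H2 & H3). cbn [fst snd] in *.
  destruct (t0fun_spec y r Hd) as [Ht Er]. set (t := t0fun a y r) in *.
  destruct (Rle_lt_dec t x) as [Hle | Hlt]; [| lra].
  destruct (Rle_lt_or_eq_dec t x Hle) as [Hlt | ->]; [| lra].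
  assert (P' := rho_int_decr y t x ltac:(lra) ltac:(lra)). lra. }
assert (Hup : F (fun p => t0fun a (fst p) (snd p) < s + eps)).
{ destruct (Rle_lt_or_eq_dec s tau ltac:(lra)) as [Hlt | Heq].
  - pose (x := Rmin (s + eps / 2) ((s + tau) / 2)).
    assert (Hx1 : x <= s + eps / 2) by apply Rmin_l.
    assert (Hx : s < x < tau) by (unfold x, Rmin in *; destruct Rle_dec; lra).
    assert (P := rho_int_decr tau s x ltac:(lra) ltac:(lra)).
    assert (Q1 := lim_lt (F := F) _ _ 0 (L3 x ltac:(lra)) ltac:(lra)).
    assert (Q2 := lim_gt (F := F) _ _ (- x) L1 ltac:(lra)).
    generalize (filter_and (F := F) _ _ Hdom (filter_and (F := F) _ _ Q1 Q2)). apply filter_imp.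
    intros [y r] (Hd & H1 & H2). cbn [fst snd] in *.
    destruct (t0fun_spec y r Hd) as [Ht Er]. set (t := t0fun a y r) in *.
    destruct (Rle_lt_dec x t) as [Hle | Hl]; [| lra].
    destruct (Rle_lt_or_eq_dec x t Hle) as [Hl | ->]; [| lra].
    assert (P' := rho_int_decr y x t ltac:(lra) ltac:(lra)). lra.
  (* When [s = tau] no test point lies above [s]; the constraint that [t0] never exceeds the time
     coordinate suffices. *)
  - assert (Q1 := lim_lt (F := F) _ _ (s + eps) L1 ltac:(lra)).
    generalize (filter_and (F := F) _ _ Hdom Q1). apply filter_imp.
    intros [y r] (Hd & H1). cbn [fst snd] in *.
    destruct (t0fun_spec y r Hd) as [Ht Er]. lra. }
change (F (fun p => ball s eps (t0fun a (fst p) (snd p)))).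
generalize (filter_and (F := F) _ _ Hlow' Hup). apply filter_imp.
intros p [H1 H2]. change (Rabs (t0fun a (fst p) (snd p) - s) < eps). apply Rabs_def1; lra.
Qed.

(** * Continuity of the metric coefficients *)

Section Polar.
Context (p : R * R) (Hp : polar_domain p).

Let F := within polar_domain (locally p).

Lemma within_polar_domain : F polar_domain.
Proof. unfold F, within. apply filter_forall. now intros x Hx. Qed.

Lemma lim_tau : filterlim fst F (locally (fst p)).
Proof. eapply filterlim_filter_le_1; [apply filter_le_within | apply lim_fst]. Qed.

Lemma lim_rho : filterlim snd F (locally (snd p)).
Proof. eapply filterlim_filter_le_1; [apply filter_le_within | apply lim_snd]. Qed.

Lemma lim_t0 : filterlim (fun q => t0fun a (fst q) (snd q)) F (locally (t0fun a (fst p) (snd p))).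
Proof. exact (t0fun_continuous p Hp). Qed.

End Polar.

Lemma t0fun_bound p : polar_domain p -> - fst p < t0fun a (fst p) (snd p) <= fst p.
Proof. destruct p as [tau rho]. intros Hp. apply (t0fun_spec tau rho Hp). Qed.

Lemma g_tautau_continuous : continuous_on polar_domain (fun p => g_tautau a (fst p) (snd p)).
Proof.
intros p Hp.
assert (E : forall q, polar_domain q ->
  - (1 - ad a (fst q) * Ffun (fst q) (t0fun a (fst q) (snd q))) ^ 2 = g_tautau a (fst q) (snd q)).
{ intros q Hq. unfold g_tautau. rewrite ffun_eq; [easy | now apply t0fun_bound]. }
apply (filterlim_within_ext polar_domain (fun q => - (1 - ad a (fst q) * Ffun (fst q) (t0fun a (fst q) (snd q))) ^ 2) _ E).
rewrite <- E by exact Hp.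
apply lim_opp, lim_pow, lim_minus; [apply filterlim_const |].
apply lim_mult.
- apply (lim_comp (ad a)); [apply ad_continuous, (proj1 Hp) | apply lim_tau].
- apply (lim_comp2 Ffun fst (fun q => t0fun a (fst q) (snd q))).
  + apply Ffun_continuous. now apply t0fun_bound.
  + apply lim_tau.
  + now apply lim_t0.
Qed.

Lemma g_thth_continuous : continuous_on polar_domain (fun p => g_thth a (fst p) (snd p)).
Proof.
intros p Hp.
assert (E : forall q, polar_domain q ->
  area (fst q) (t0fun a (fst q) (snd q)) = g_thth a (fst q) (snd q)).
{ intros q Hq. symmetry. apply g_thth_eq. now apply t0fun_bound. }
apply (filterlim_within_ext polar_domain (fun q => area (fst q) (t0fun a (fst q) (snd q))) _ E).
rewrite <- E by exact Hp.
apply (lim_comp2 area fst (fun q => t0fun a (fst q) (snd q))).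
- apply area_continuous, (proj1 Hp).
- apply lim_tau.
- now apply lim_t0.
Qed.

(** * The coefficient [lambda0], away from and near [rho = 0] *)

Lemma lambda0_continuous_pos p : polar_domain p -> 0 < snd p ->
  filterlim (fun q => lambda0 a (fst q) (snd q)) (within polar_domain (locally p))
    (locally (lambda0 a (fst p) (snd p))).
Proof.
intros Hp Hr.
apply (filterlim_ext_loc (fun q => (g_thth a (fst q) (snd q) - snd q ^ 2) / snd q ^ 4)).
- assert (H := lim_gt _ _ 0 (lim_rho p) Hr). revert H. apply filter_imp.
  intros q Hq. unfold lambda0. now destruct (Rlt_dec 0 (snd q)).
- unfold lambda0. destruct (Rlt_dec 0 (snd p)) as [_ | ]; [| easy].
  apply lim_div; [apply pow_nonzero; lra | |].
  + apply lim_minus; [exact (g_thth_continuous p Hp) | apply lim_pow, lim_rho].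
  + apply lim_pow, lim_rho.
Qed.

Lemma rhoM_pos tau : 0 < tau -> 0 < rhoM a tau.
Proof.
intros Htau. assert (H := rho_int_decr_pos tau 0 tau ltac:(lra) ltac:(lra)).
rewrite rho_int_diag in H. now rewrite rhoM_eq.
Qed.

Lemma t0fun_0 tau : 0 < tau -> t0fun a tau 0 = tau.
Proof.
intros Htau.
assert (HM := rhoM_pos tau Htau).
destruct (t0fun_spec tau 0) as [Hs E].
{ split; cbn [fst snd]; lra. }
destruct (Rle_lt_or_eq_dec _ _ (proj2 Hs)) as [Hlt | ]; [| easy].
assert (P := rho_int_decr tau _ tau (conj (proj1 Hs) Hlt) (Rle_refl _)).
rewrite rho_int_diag in P. lra.
Qed.

(* Both integrals carry the same factor [sqrt (tau - t0)], which cancels in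
   [g_thth / rho ^ 2]. *)
Lemma lambda0_sqr_eq q : polar_domain q -> 0 < t0fun a (fst q) (snd q) ->
  lambda0 a (fst q) (snd q) * snd q ^ 2 =
  (Xint (fst q) (t0fun a (fst q) (snd q)) / Yint (fst q) (t0fun a (fst q) (snd q))) ^ 2 - 1.
Proof.
destruct q as [tau rho]. intros Hq Ht. cbn [fst snd] in *.
assert (Hb := t0fun_bound _ Hq). cbn [fst snd] in Hb.
assert (HY := Yint_pos tau (t0fun a tau rho) ltac:(lra) ltac:(lra)).
assert (Hrho := proj2 (t0fun_spec tau rho Hq)).
unfold lambda0. destruct (Rlt_dec 0 rho) as [Hr | Hr].
- rewrite (g_thth_eq tau rho Hb). unfold area.
  set (s := t0fun a tau rho) in *. rewrite (Rabs_pos_eq s) by lra.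
  assert (Hs : 0 < tau - s).
  { destruct (Rle_lt_or_eq_dec s tau (proj2 Hb)) as [H | H]; [lra |].
    rewrite H, rho_int_diag in Hrho. lra. }
  assert (E : (tau - s) * Yint tau s ^ 2 = rho ^ 2).
  { rewrite Hrho. unfold rho_int. rewrite Rpow_mult_distr, pow2_sqrt by lra. ring. }
  replace (rho ^ 4) with (rho ^ 2 * rho ^ 2) by ring. rewrite <- E.
  field. lra.
(* At [rho = 0] the left side is zero, and the right side vanishes because the two diagonal values
   agree. *)
- destruct Hq as [Htau Hq]. cbn [fst snd] in *. replace rho with 0 by lra.
  rewrite t0fun_0, Xint_diag, Yint_diag by easy.
  assert (H1 := sqrt_slope_pos tau tau Htau ltac:(lra)).
  assert (H2 := aext_pos tau ltac:(lra)). rewrite aext_pos_eq in H2 by lra.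
  field. lra.
Qed.

(** Near [rho = 0] the point [t0] is close to [tau > 0], so the quotient formula applies, and its
    limit is [1 - 1]. Only the product with [rho^2] is controlled; no limit of [lambda0] itself is
    claimed. *)
Lemma lambda0_sqr_lim0 tau : 0 < tau -> polar_domain (tau, 0) ->
  filterlim (fun q => lambda0 a (fst q) (snd q) * snd q ^ 2)
    (within polar_domain (locally (tau, 0))) (locally 0).
Proof.
intros Htau Hp.
assert (L := lim_t0 (tau, 0) Hp). cbn [fst snd] in L. rewrite t0fun_0 in L by easy.
apply (filterlim_ext_loc (fun q =>
  (Xint (fst q) (t0fun a (fst q) (snd q)) / Yint (fst q) (t0fun a (fst q) (snd q))) ^ 2 - 1)).
- generalize (filter_and _ _ (within_polar_domain (tau, 0)) (lim_gt (F := within polar_domain (locally (tau, 0))) _ _ 0 L Htau)).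
  apply filter_imp. intros q [Hq Ht]. symmetry. now apply lambda0_sqr_eq.
- assert (HY := Yint_pos tau tau Htau ltac:(lra)).
  replace 0 with ((Xint tau tau / Yint tau tau) ^ 2 - 1) at 2.
  + apply lim_minus; [| apply filterlim_const]. apply lim_pow. apply lim_div; [lra | |].
    * apply (lim_comp2 Xint fst (fun q => t0fun a (fst q) (snd q))); [now apply Xint_continuous | apply lim_tau | exact L].
    * apply (lim_comp2 Yint fst (fun q => t0fun a (fst q) (snd q))); [apply Yint_continuous; lra | apply lim_tau | exact L].
  + rewrite Xint_diag, <- Yint_diag by easy. field. lra.
Qed.

(** * Transfer to the Cartesian and polar charts *)

Lemma rho_max_le tau : 0 < tau -> rho_max a tau <= 2 * rhoM a tau.
Proof.
intros Htau. assert (HM := rhoM_pos tau Htau). unfold rho_max.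
destruct (excluded_middle_informative _) as [[r [Hr Hr0]] | _]; [| lra].
set (S := fun r => 0 < r < 2 * rhoM a tau /\ g_tautau a tau r = 0).
assert (Hglb := proj1 (Glb_Rbar_correct S) r (conj Hr Hr0)).
destruct (Glb_Rbar S) as [x | |]; simpl in *; lra.
Qed.

Lemma Fermi_polar_domain p : D_Fermi a p -> polar_domain (tau_radius p).
Proof.
destruct p as [[[tau x] y] z]. intros [Htau Hr].
split; cbn [tau_radius fst snd]; [easy |].
assert (H := rho_max_le tau Htau). assert (0 <= radius x y z) by apply sqrt_pos. lra.
Qed.

Lemma gF_tt_continuous : continuous_on (D_Fermi a) (gF_tt a).
Proof.
intros p Hp.
apply (filterlim_ext (fun p => g_tautau a (fst (tau_radius p)) (snd (tau_radius p)))).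
- now intros [[[? ?] ?] ?].
- replace (gF_tt a p) with (g_tautau a (fst (tau_radius p)) (snd (tau_radius p)))
    by now destruct p as [[[? ?] ?] ?].
  apply (lim_within_map _ polar_domain tau_radius (fun q => g_tautau a (fst q) (snd q))).
  + exact Fermi_polar_domain.
  + apply tau_radius_continuous.
  + apply g_tautau_continuous. now apply Fermi_polar_domain.
Qed.

(** Where [rho > 0], both factors are continuous. At [rho = 0] the product is squeezed by
    [|lambda0 rho^2|], which tends to [0]. *)
Lemma lambda0_mult_continuous (w : R * R * R * R -> R) :
  (forall p, continuous w p) -> (forall p, Rabs (w p) <= x4 p ^ 2 + y4 p ^ 2 + z4 p ^ 2) ->
  continuous_on (D_Fermi a) (fun p => lambda0 a (fst (tau_radius p)) (snd (tau_radius p)) * w p).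
Proof.
intros Hw Hb p Hp.
assert (Hd := Fermi_polar_domain p Hp).
assert (Hr : forall p, x4 p ^ 2 + y4 p ^ 2 + z4 p ^ 2 = snd (tau_radius p) ^ 2).
{ intros [[[tau x] y] z]. unfold x4, y4, z4, tau_radius, radius; cbn [fst snd].
  rewrite pow2_sqrt; [easy |]. nra. }
destruct (Rle_lt_or_eq_dec 0 (snd (tau_radius p))) as [Hpos | H0].
- apply Hd.
- apply lim_mult.
  + apply (lim_within_map _ polar_domain tau_radius (fun q => lambda0 a (fst q) (snd q))).
    * exact Fermi_polar_domain.
    * apply tau_radius_continuous.
    * now apply lambda0_continuous_pos.
  + eapply filterlim_filter_le_1; [apply filter_le_within | apply Hw].
- replace (lambda0 a (fst (tau_radius p)) (snd (tau_radius p)) * w p) with 0.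
  2: { rewrite <- H0. unfold lambda0. destruct (Rlt_dec 0 0); lra. }
  apply (lim_bound0 _ (fun p => Rabs (lambda0 a (fst (tau_radius p)) (snd (tau_radius p)) * snd (tau_radius p) ^ 2))).
  + apply filter_forall. intros q. rewrite !Rabs_mult, <- Hr.
    apply Rmult_le_compat_l; [apply Rabs_pos |].
    apply Rle_trans with (2 := Rle_abs _). apply Hb.
  + rewrite <- Rabs_R0. apply lim_abs.
    apply (lim_within_map _ polar_domain tau_radius (fun q => lambda0 a (fst q) (snd q) * snd q ^ 2)).
    * exact Fermi_polar_domain.
    * apply tau_radius_continuous.
    * destruct (tau_radius p) as [tau r]. cbn [fst snd] in *. subst r.
      apply lambda0_sqr_lim0; [exact (proj1 Hd) | exact Hd].
Qed.

Definition proj_polar (p : R * R * R * R) : R * R := fst (fst p).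

Lemma polar_polar_domain c d p : D_polar a c d p -> polar_domain (proj_polar p).
Proof.
destruct p as [[[tau rho] theta] phi]. intros (Htau & Hr & _).
split; cbn [proj_polar fst snd]; [easy |].
assert (H := rho_max_le tau Htau). lra.
Qed.

Lemma polar_continuous c d (g : R * R -> R) : continuous_on polar_domain g ->
  continuous_on (D_polar a c d) (fun p => g (proj_polar p)).
Proof.
intros Hg p Hp.
apply (lim_within_map _ polar_domain proj_polar g).
- apply polar_polar_domain.
- exact (filterlim_comp _ _ _ _ _ _ _ _ (lim_fst p) (lim_fst (fst p))).
- apply Hg. now apply (polar_polar_domain c d).
Qed.

End ScaleFactor.

(** * Reduction of all metric coefficients to continuous functions of [(tau, rho)] *)

Theorem theorem7p10 (a : R -> R) (Ha : strongly_regular_scale_factor a) :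
  (continuous_on (D_Fermi a) (gF_tt a) /\
   continuous_on (D_Fermi a) (gF_xx a) /\
   continuous_on (D_Fermi a) (gF_yy a) /\
   continuous_on (D_Fermi a) (gF_zz a) /\
   continuous_on (D_Fermi a) (gF_xy a) /\
   continuous_on (D_Fermi a) (gF_xz a) /\
   continuous_on (D_Fermi a) (gF_yz a)) /\
  (forall c d : R,
   continuous_on (D_polar a c d) (gP_tt a) /\
   continuous_on (D_polar a c d) (gP_rr a) /\
   continuous_on (D_polar a c d) (gP_thth a) /\
   continuous_on (D_polar a c d) (gP_phph a)).
Proof.
destruct Ha as [Hreg (K & HK & Hlow)].
pose (lam p := lambda0 a (fst (tau_radius p)) (snd (tau_radius p))).
assert (Hdiag : forall u v : R * R * R * R -> R,
  (forall p, continuous u p) -> (forall p, continuous v p) ->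
  (forall p, u p ^ 2 + v p ^ 2 <= x4 p ^ 2 + y4 p ^ 2 + z4 p ^ 2) ->
  continuous_on (D_Fermi a) (fun p => 1 + lam p * (u p ^ 2 + v p ^ 2))).
{ intros u v Hu Hv Hb p Hp. apply lim_plus; [apply filterlim_const |].
  apply (lambda0_mult_continuous a Hreg (fun p => u p ^ 2 + v p ^ 2)); [| | exact Hp].
  - intros q. apply lim_plus; apply lim_pow; [apply Hu | apply Hv].
  - intros q. rewrite Rabs_pos_eq; [apply Hb |].
    assert (H1 := pow2_ge_0 (u q)). assert (H2 := pow2_ge_0 (v q)). lra. }
assert (Hoff : forall u v : R * R * R * R -> R,
  (forall p, continuous u p) -> (forall p, continuous v p) ->
  (forall p, u p ^ 2 + v p ^ 2 <= x4 p ^ 2 + y4 p ^ 2 + z4 p ^ 2) ->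
  continuous_on (D_Fermi a) (fun p => - (lam p * (u p * v p)))).
(* The mixed terms obey the same domination, since [|u v| <= u^2 + v^2]. *)
{ intros u v Hu Hv Hb p Hp. apply lim_opp.
  apply (lambda0_mult_continuous a Hreg (fun p => u p * v p)); [| | exact Hp].
  - intros q. apply lim_mult; [apply Hu | apply Hv].
  - intros q. eapply Rle_trans; [| apply Hb]. apply Rabs_le. split; nra. }
assert (Hpos := fun t => pow2_ge_0 t).
split.
- repeat split.
  + exact (gF_tt_continuous a Hreg K HK Hlow).
  + refine (continuous_on_eq _ _ _ _ (Hdiag y4 z4 lim_y4 lim_z4 _)); [now intros [[[? ?] ?] ?] |].
    intros p. specialize (Hpos (x4 p)). lra.
  + refine (continuous_on_eq _ _ _ _ (Hdiag x4 z4 lim_x4 lim_z4 _)); [now intros [[[? ?] ?] ?] |].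
    intros p. specialize (Hpos (y4 p)). lra.
  + refine (continuous_on_eq _ _ _ _ (Hdiag x4 y4 lim_x4 lim_y4 _)); [now intros [[[? ?] ?] ?] |].
    intros p. specialize (Hpos (z4 p)). lra.
  + refine (continuous_on_eq _ _ _ _ (Hoff x4 y4 lim_x4 lim_y4 _)).
    * intros [[[? ?] ?] ?]. unfold gF_xy, lam, x4, y4. cbn. ring.
    * intros p. specialize (Hpos (z4 p)). lra.
  + refine (continuous_on_eq _ _ _ _ (Hoff x4 z4 lim_x4 lim_z4 _)).
    * intros [[[? ?] ?] ?]. unfold gF_xz, lam, x4, z4. cbn. ring.
    * intros p. specialize (Hpos (y4 p)). lra.
  + refine (continuous_on_eq _ _ _ _ (Hoff y4 z4 lim_y4 lim_z4 _)).
    * intros [[[? ?] ?] ?]. unfold gF_yz, lam, y4, z4. cbn. ring.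
    * intros p. specialize (Hpos (x4 p)). lra.
- intros c d.
  assert (Hth : continuous_on (D_polar a c d) (fun p => g_thth a (fst (proj_polar p)) (snd (proj_polar p))))
    by exact (polar_continuous a Hreg c d _ (g_thth_continuous a Hreg)).
  repeat split.
  + refine (continuous_on_eq _ _ _ _ (polar_continuous a Hreg c d _ (g_tautau_continuous a Hreg K HK Hlow))).
    now intros [[[? ?] ?] ?].
  + intros p _. unfold gP_rr. apply filterlim_const.
  + refine (continuous_on_eq _ _ _ _ Hth). now intros [[[? ?] ?] ?].
  (* The angle [theta] is the third coordinate, hence [y4]. *)
  + apply (continuous_on_eq _ (fun p => g_thth a (fst (proj_polar p)) (snd (proj_polar p)) * sin (y4 p) ^ 2)).
    * now intros [[[? ?] ?] ?].
    * intros p Hp. apply lim_mult; [exact (Hth p Hp) |].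
      apply lim_pow. apply (lim_comp sin); [apply continuous_sin |].
      eapply filterlim_filter_le_1; [apply filter_le_within | apply lim_y4].
Qed.
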